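(* Let $\mathcal{G}$ be the star graph with $p_1>0$ leads and $p_2\ge0$ finite edges, let ${\bf H}_{\alpha,Q}$ be the Hamiltonian with $\delta$-type vertex conditions and let the minimal operator $A$ be non-negative, $A\ge0$. Then $$\kappa_-({\bf H}_{\alpha,Q})\le(p_2+1)m.$$
   Context: Let $m\ge1$. The star graph $\mathcal{G}$ has a central vertex $v_0=0$; each lead is identified with $[0,\infty)$ with $x=0$ at $v_0$; each finite edge $e_{p_1+k}$ ($1\le k\le p_2$), of length $|e_{p_1+k}|\in(0,\infty)$, is identified with $(0,|e_{p_1+k}|)$ with $x=0$ at $v_0$ and $x=|e_{p_1+k}|$ at the loose end $v_k$. $\mathcal{V}=\{v_0,\dots,v_{p_2}\}$. $Q=\bigoplus_eQ_e$ with $Q_e\in L^1(e;\mathbb{C}^{m\times m})$, $Q_e(x)=Q_e(x)^*$ a.e., and $\alpha:\mathcal{V}\to\mathbb{C}^{m\times m}$ with $\alpha(v)=\alpha(v)^*$. On each edge, $A_{e,\max}f=-f''+Q_ef$ on $\{f\in L^2(e;\mathbb{C}^m): f,f'\in AC_{\rm loc}(e;\mathbb{C}^m),\ -f''+Q_ef\in L^2\}$, and the minimal operator $A_e$ is its restriction to $f$ with $f=f'=0$ at all finite endpoints of $e$. $A=\bigoplus_eA_e$ in $L^2(\mathcal{G};\mathbb{C}^m)=\bigoplus_eL^2(e;\mathbb{C}^m)$, $A^*=\bigoplus_eA_{e,\max}$. ${\bf H}_{\alpha,Q}$ is the (self-adjoint) restriction of $A^*$ to those $f$ continuous at each vertex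 with $\sum_{e\ni v}f_e'(v)=\alpha(v)f(v)$ for each $v\in\mathcal{V}$, where $f'_e(v)$ is the outgoing derivative ($f_e'(0)$ at $v_0$; $-f_e'(|e|)$ at a loose end). $\kappa_-(T)=\dim E_T(-\infty,0)$ for a self-adjoint operator $T$ with spectral measure $E_T$. *)

(* Defs.v *)
From HB Require Import structures.
From mathcomp Require Import all_boot all_order all_algebra.
From mathcomp Require Import ring_quotient.
From mathcomp Require Import all_classical all_reals all_analysis.
From mathcomp Require Import measurable_realfun.
From mathcomp Require Import complex.
From mathcomp Require Import ring.
Set Implicit Arguments.
Unset Strict Implicit.
Unset Printing Implicit Defensive.
Import Order.TTheory GRing.Theory Num.Theory.
Import numFieldNormedType.Exports.
Local Open Scope classical_set_scope.
Local Open Scope ring_scope.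
Local Open Scope complex_scope.

Section QuotientLmodule.
Context (K : pzRingType) (V : lmodType K) (N : zmodClosed V).
Context (N_scale : GRing.scaler_closed N).
Local Open Scope quotient_scope.
Local Notation Q := (Quotient.quot N).

Definition quot_scale (a : K) (u : Q) : Q := \pi_Q (a *: repr u).

Lemma pi_quot_scale a (x : V) : quot_scale a (\pi_Q x) = \pi_Q (a *: x).
Proof.
apply/eqP; rewrite /quot_scale -Quotient.idealrBE -scalerBr.
by rewrite N_scale// Quotient.idealrBE reprK.
Qed.

Lemma pi_quot_add (x y : V) : \pi_Q x + \pi_Q y = \pi_Q (x + y).
Proof. symmetry; exact: (Quotient.pi_add N x y). Qed.

Lemma quot_scalerA a b u : quot_scale a (quot_scale b u) = quot_scale (a * b) u.
Proof. by elim/quotW: u => x; rewrite (pi_quot_scale b x) !pi_quot_scale scalerA. Qed.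

Lemma quot_scale1r : left_id 1 quot_scale.
Proof. by elim/quotW => x; rewrite pi_quot_scale scale1r. Qed.

Lemma quot_scalerDr : right_distributive quot_scale +%R.
Proof.
move=> a; elim/quotW => x; elim/quotW => y; rewrite pi_quot_add.
by rewrite (pi_quot_scale a x) (pi_quot_scale a y) pi_quot_scale pi_quot_add scalerDr.
Qed.

Lemma quot_scalerDl u : {morph quot_scale^~ u : a b / a + b}.
Proof.
by elim/quotW: u => x a b; rewrite (pi_quot_scale a x) (pi_quot_scale b x) pi_quot_scale pi_quot_add scalerDl.
Qed.

End QuotientLmodule.

Section SpectralMeasure.
Context (R : realType) (H : lmodType R[i]) (ip : H -> H -> R[i]).

Definition lin_indep n (v : 'I_n -> H) :=
  forall c : 'I_n -> R[i], \sum_i c i *: v i = 0 -> forall i, c i = 0.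

Definition dimension (W : set H) : \bar R :=
  ereal_sup [set n%:R%:E | n in
    [set n : nat | exists2 v : 'I_n -> H, (forall i, W (v i)) & lin_indep v]].

(* Unbounded operators are represented by their graphs. *)
Definition nonneg_operator (T : set (H * H)) :=
  forall u w, T (u, w) -> 0 <= ip w u.

(* [pm_dist x] is the measure B |-> <E(B)x, x>; that it is a measure for every
   x is the (weak, equivalently strong) sigma-additivity of E. *)
Record projection_measure := ProjectionMeasure {
  pm_proj :> set R -> {linear H -> H} ;
  pm_idem : forall B, measurable B ->
    forall x, pm_proj B (pm_proj B x) = pm_proj B x ;
  pm_selfadjoint : forall B, measurable B ->
    forall x y, ip (pm_proj B x) y = ip x (pm_proj B y) ;
  pm_setT : forall x, pm_proj setT x = x ;
  pm_dist : H -> {measure set (measurableTypeR R) -> \bar R} ;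
  pm_distE : forall x B, measurable B ->
    pm_dist x B = (complex.Re (ip (pm_proj B x) x))%:E }.

(* T is the integral of lambda dE(lambda): its domain consists of the x such
   that lambda is square integrable for <E x, x>, and on it
   <Tx, x> = \int lambda d<E x, x>, which determines T by polarization. *)
Definition spectral_measure_of (T : set (H * H)) (E : projection_measure) :=
  (forall x, (exists y, T (x, y)) <->
     (\int[pm_dist E x]_t ((t ^+ 2)%:E) < +oo)%E) /\
  (forall x y, T (x, y) -> ip y x = (\int[pm_dist E x]_t t)%:C).

Definition kappa_minus (E : projection_measure) : \bar R :=
  dimension (range (E `]-oo, 0%R[%classic)).

End SpectralMeasure.

Section Entrywise.
Context (R : realType).
Local Notation mu := (@lebesgue_measure R).

Definition real_entries (P : (R -> R) -> Prop) m n (F : R -> 'M[R[i]]_(m, n)) :=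
  forall i j, P (fun x => complex.Re (F x i j)) /\
              P (fun x => complex.Im (F x i j)).

Definition mx_cvg (F : set_system R) m n (f : R -> 'M[R[i]]_(m, n))
    (c : 'M[R[i]]_(m, n)) :=
  forall i j, ((fun x => complex.Re (f x i j)) @ F --> complex.Re (c i j)) /\
              ((fun x => complex.Im (f x i j)) @ F --> complex.Im (c i j)).

Definition mx_is_derive (x : R) m n (f : R -> 'M[R[i]]_(m, n))
    (d : 'M[R[i]]_(m, n)) :=
  forall i j, is_derive x 1 (fun y => complex.Re (f y i j)) (complex.Re (d i j)) /\
              is_derive x 1 (fun y => complex.Im (f y i j)) (complex.Im (d i j)).

Definition sq_integrable (D : set R) (h : R -> R) :=
  measurable_fun D h /\ (\int[mu]_(x in D) ((h x ^+ 2)%:E) < +oo)%E.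

Definition L1fun (D : set R) (h : R -> R) := mu.-integrable D (EFin \o h).

Definition abs_continuous (a b : R) (h : R -> R) :=
  forall eps, 0 < eps -> exists2 delta, 0 < delta &
  forall n (s t : 'I_n -> R),
    (forall i, [/\ a <= s i, s i <= t i & t i <= b]) ->
    (forall i j, i != j -> t i <= s j \/ t j <= s i) ->
    \sum_i (t i - s i) < delta -> \sum_i `|h (t i) - h (s i)| < eps.

Definition AC_loc (D : set R) (h : R -> R) :=
  forall a b, a <= b -> `[a, b]%classic `<=` D -> abs_continuous a b h.

Definition cintegral (D : set R) (h : R -> R[i]) : R[i] :=
  (\int[mu]_(x in D) complex.Re (h x)) +i* (\int[mu]_(x in D) complex.Im (h x)).

End Entrywise.

Section L2.
Context (R : realType) (I : finType) (D : I -> interval R) (m : nat).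
Local Notation mu := (@lebesgue_measure R).

Definition L2_pred : {pred I -> R -> 'cV[R[i]]_m} :=
  fun f => `[< forall e, real_entries (sq_integrable [set` D e]) (f e) >].

Lemma sq_integrableD (A : interval R) (f g : R -> R) :
  sq_integrable [set` A] f -> sq_integrable [set` A] g ->
  sq_integrable [set` A] (fun x => f x + g x).
Proof.
have mA : measurable [set` A] by exact: measurable_itv.
move=> [mf fi] [mg gi]; split; first exact: measurable_funD.
have m2 (h : R -> R) : measurable_fun [set` A] h ->
    measurable_fun [set` A] (fun x => (h x ^+ 2)%:E).
  by move=> mh; apply/measurable_EFinP; exact: measurable_funX.
have p2 (h : R -> R) x : [set` A] x -> (0 <= (h x ^+ 2)%:E)%E.
  by move=> _; rewrite lee_fin sqr_ge0.
have i2 (h : R -> R) : measurable_fun [set` A] h ->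
    (\int[mu]_(x in [set` A]) (h x ^+ 2)%:E < +oo)%E ->
    (\int[mu]_(x in [set` A]) (2%:E * (h x ^+ 2)%:E) < +oo)%E.
  move=> mh hi; rewrite ge0_integralZl_EFin ?ler0n//; [|exact: p2|exact: m2].
  by apply: lte_mul_pinfty; rewrite ?lee_fin.
have mm (h : R -> R) : measurable_fun [set` A] h ->
    measurable_fun [set` A] (fun x => 2%:E * (h x ^+ 2)%:E)%E.
  by move=> mh; apply: emeasurable_funM => //; exact: m2.
have pp (h : R -> R) x : [set` A] x -> (0 <= 2%:E * (h x ^+ 2)%:E)%E.
  by move=> Ax; rewrite mule_ge0 ?p2 ?lee_fin.
apply: (@le_lt_trans _ _
  (\int[mu]_(x in [set` A]) (2%:E * (f x ^+ 2)%:E + 2%:E * (g x ^+ 2)%:E))%E).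
  apply: ge0_le_integral => //.
  - exact: (p2 (fun x => f x + g x)).
  - by apply: (m2 (fun x => f x + g x)); exact: measurable_funD.
  - by apply: emeasurable_funD; exact: mm.
  - move=> x _; rewrite -!EFinM -EFinD lee_fin -subr_ge0.
    by rewrite [leRHS](_ : _ = (f x - g x) ^+ 2) ?sqr_ge0//; ring.
rewrite ge0_integralD//; [|exact: pp|exact: mm|exact: pp|exact: mm].
by apply: lte_add_pinfty; exact: i2.
Qed.

Lemma sq_integrableZ (A : interval R) a (f : R -> R) :
  sq_integrable [set` A] f -> sq_integrable [set` A] (fun x => a * f x).
Proof.
have mA : measurable [set` A] by exact: measurable_itv.
move=> [mf fi]; split; first exact: measurable_funM.
under eq_integral do rewrite exprMn EFinM.
rewrite ge0_integralZl_EFin ?sqr_ge0//.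
- by apply: lte_mul_pinfty; rewrite ?lee_fin ?sqr_ge0.
- by move=> x _; rewrite lee_fin sqr_ge0.
- by apply/measurable_EFinP; exact: measurable_funX.
Qed.

Lemma sq_integrable0 (A : interval R) : sq_integrable [set` A] (cst 0).
Proof.
split; first exact: measurable_cst.
by rewrite integral0_eq ?ltry// => x _; rewrite expr0n.
Qed.

Lemma L2_submod_closed : submod_closed L2_pred.
Proof.
have ReE (z w : R[i]) : complex.Re (z + w) = complex.Re z + complex.Re w.
  by case: z; case: w.
have ImE (z w : R[i]) : complex.Im (z + w) = complex.Im z + complex.Im w.
  by case: z; case: w.
have RME (z w : R[i]) : complex.Re (z * w) =
    complex.Re z * complex.Re w + (- complex.Im z) * complex.Im w.
  by case: z; case: w => * /=; rewrite mulNr.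
have IME (z w : R[i]) : complex.Im (z * w) =
    complex.Re z * complex.Im w + complex.Im z * complex.Re w.
  by case: z; case: w.
split.
  apply/asboolP => e i j; split.
  - rewrite [X in sq_integrable _ X](_ : _ = cst 0); first exact: sq_integrable0.
    by apply/funext => x; rewrite mxE.
  - rewrite [X in sq_integrable _ X](_ : _ = cst 0); first exact: sq_integrable0.
    by apply/funext => x; rewrite mxE.
move=> a f g /asboolP f2 /asboolP g2; apply/asboolP => e i j.
have [f1 f3] := f2 e i j; have [g1 g3] := g2 e i j.
split.
- rewrite [X in sq_integrable _ X](_ : _ = (fun x =>
     (complex.Re a * complex.Re (f e x i j) +
      - complex.Im a * complex.Im (f e x i j)) + complex.Re (g e x i j))).
    by apply: sq_integrableD => //; apply: sq_integrableD; exact: sq_integrableZ.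
  by apply/funext => x; rewrite !mxE ReE RME.
- rewrite [X in sq_integrable _ X](_ : _ = (fun x =>
     (complex.Re a * complex.Im (f e x i j) +
      complex.Im a * complex.Re (f e x i j)) + complex.Im (g e x i j))).
    by apply: sq_integrableD => //; apply: sq_integrableD; exact: sq_integrableZ.
  by apply/funext => x; rewrite !mxE ImE IME.
Qed.

HB.instance Definition _ := GRing.isSubmodClosed.Build R[i]
  (I -> R -> 'cV[R[i]]_m) L2_pred L2_submod_closed.

Record L2fun := MkL2fun {
  L2fun_val :> I -> R -> 'cV[R[i]]_m ;
  L2funP : L2fun_val \in L2_pred }.

HB.instance Definition _ := [isSub for L2fun_val].
HB.instance Definition _ := [Choice of L2fun by <:].
HB.instance Definition _ := [SubChoice_isSubLmodule of L2fun by <:].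

Definition L2null : {pred L2fun} :=
  fun f => `[< forall e, {ae mu, forall x, [set` D e] x -> f e x = 0} >].

Lemma L2null_submod_closed : submod_closed L2null.
Proof.
split; first by apply/asboolP => e; apply: aeW.
move=> a f g /asboolP f0 /asboolP g0; apply/asboolP => e.
apply: (@filterS2 _ _ (ae_filter_ringOfSetsType mu) _ _ _ _ (f0 e) (g0 e)).
move=> x fx gx Dx.
by rewrite -[LHS]/(a *: f e x + g e x) fx// gx// scaler0 addr0.
Qed.

Lemma L2null_scaler_closed : GRing.scaler_closed L2null.
Proof.
exact: GRing.subsemimod_closedZ (GRing.submod_closed_semi L2null_submod_closed).
Qed.

HB.instance Definition _ := GRing.isZmodClosed.Build
  L2fun L2null (GRing.submod_closedB L2null_submod_closed).

(* The direct sum over e of the spaces L^2(D e; C^m), as a quotient modulo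
   almost everywhere equality. *)
Definition L2 : Type := Quotient.quot L2null.

HB.instance Definition _ := GRing.Zmodule.on L2.
HB.instance Definition _ := GRing.Zmodule_isLmodule.Build R[i] L2
  (quot_scalerA L2null_scaler_closed) (quot_scale1r L2null_scaler_closed)
  (quot_scalerDr L2null_scaler_closed) (quot_scalerDl L2null_scaler_closed).

Definition L2repr (u : L2) : L2fun := repr (u : Quotient.quot L2null).

Definition represents (f : I -> R -> 'cV[R[i]]_m) (u : L2) :=
  forall e, {ae mu, forall x, [set` D e] x -> f e x = L2repr u e x}.

Definition L2ip (u v : L2) : R[i] :=
  \sum_e \sum_i cintegral [set` D e]
    (fun x => L2repr u e x i 0 * (L2repr v e x i 0)^*).

End L2.

Section StarGraph.
Context (R : realType) (p1 p2 m : nat).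
Local Notation mu := (@lebesgue_measure R).

(* [inl _] are the leads, [inr k] the finite edges. *)
Definition star_edge : finType := ('I_p1 + 'I_p2)%type.

(* [None] is the central vertex, [Some k] the loose end of [inr k]. *)
Definition star_vertex : finType := option 'I_p2.

Context (len : 'I_p2 -> R).

Definition edge_itv (e : star_edge) : interval R :=
  match e with
  | inl _ => `[0, +oo[
  | inr k => `]0, len k[
  end.

Local Notation L2G := (L2 edge_itv m).
Context (Q : star_edge -> R -> 'M[R[i]]_m).

(* f, f' = f1 are locally absolutely continuous and w = - f'' + Qe f. *)
Definition SL_expression (D : set R) (Qe : R -> 'M[R[i]]_m)
    (f f1 w : R -> 'cV[R[i]]_m) :=
  [/\ real_entries (AC_loc D) f,
      real_entries (AC_loc D) f1,
      {ae mu, forall x, D x -> mx_is_derive x f (f1 x)} &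
      exists2 f2 : R -> 'cV[R[i]]_m,
        {ae mu, forall x, D x -> mx_is_derive x f1 (f2 x)} &
        {ae mu, forall x, D x -> w x = - f2 x + Qe x *m f x} ].

(* (u, w) is in the graph of the direct sum of the operators A_{e,max}, the
   class u having the representative f with derivative f1. *)
Definition maximal_pair (f f1 : star_edge -> R -> 'cV[R[i]]_m) (u w : L2G) :=
  represents f u /\
  forall e, SL_expression [set` edge_itv e] (Q e) (f e) (f1 e) (L2repr w e).

(* Boundary values are one-sided limits: they exist because Q is integrable up
   to the finite endpoints, although 0 and len k do not belong to the open
   interval of a finite edge. *)
Definition minimal_operator : set (L2G * L2G) := [set uw |
  exists f f1, [/\ maximal_pair f f1 uw.1 uw.2,
    forall e, mx_cvg 0^'+ (f e) 0 /\ mx_cvg 0^'+ (f1 e) 0 &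
    forall k, mx_cvg (len k)^'- (f (inr k)) 0 /\
              mx_cvg (len k)^'- (f1 (inr k)) 0]].

Context (alpha : star_vertex -> 'M[R[i]]_m).

Definition delta_conditions (f f1 : star_edge -> R -> 'cV[R[i]]_m) :=
  (exists (c : 'cV[R[i]]_m) (d : star_edge -> 'cV[R[i]]_m),
     (forall e, mx_cvg 0^'+ (f e) c /\ mx_cvg 0^'+ (f1 e) (d e)) /\
     \sum_e d e = alpha None *m c) /\
  (forall k, exists c d : 'cV[R[i]]_m,
     [/\ mx_cvg (len k)^'- (f (inr k)) c,
         mx_cvg (len k)^'- (f1 (inr k)) d &
         - d = alpha (Some k) *m c]).

Definition delta_hamiltonian : set (L2G * L2G) := [set uw |
  exists f f1, maximal_pair f f1 uw.1 uw.2 /\ delta_conditions f f1].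

End StarGraph.

Arguments L2ip {R I} D m u v.
Arguments minimal_operator {R p1 p2 m} len Q.
Arguments delta_hamiltonian {R p1 p2 m} len Q alpha.

(* Main.v *)
Require Import Defs.
From HB Require Import structures.
From mathcomp Require Import all_boot all_order all_algebra.
From mathcomp Require Import all_classical all_reals all_analysis.
From mathcomp Require Import complex.
From mathcomp Require Import measurable_realfun ring lra.
Set Implicit Arguments.
Unset Strict Implicit.
Unset Printing Implicit Defensive.
Import Order.TTheory GRing.Theory Num.Theory.
Import numFieldNormedType.Exports.
Local Open Scope classical_set_scope.
Local Open Scope ring_scope.
Local Open Scope complex_scope.

(** Negative spectrum of the Hamiltonian is detected by its quadratic form. If
    the spectral subspace of the negative half-line had dimension larger than
    [k = (p2 + 1) m], then some window [[-N, 0)] would already carry more than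
    [k] independent vectors ([lin_indep_window]). Vectors with spectrum in the
    window lie in the domain, and the form is negative on the nonzero ones
    ([window_negative]). An element of the domain has one value in [C^m] at each
    of the [p2 + 1] vertices, hence [k] scalar values in all, so some nonzero
    combination of these vectors vanishes at every vertex ([kappa_minus_le]).

    This contradicts the fact that the form is nonnegative on the functions [f]
    of the maximal domain that vanish at the vertices ([dirichlet_nonneg]);
    abstractly, the Dirichlet operator is the Friedrichs extension of the
    minimal one. It is obtained here by hand. Let [phi] be a real cutoff that
    vanishes at the ends of the edges and equals [1] away from them. Since
    [f = O(dist)] and [f'] is bounded near an end, [phi f] belongs to the
    minimal domain, and an integration by parts gives, with [w = - f'' + Q f],
      [Re <A (phi f), phi f> = \int phi^2 Re <w, f> + \int phi'^2 |f|^2]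
    ([cut_energy]). When the cutoff is concentrated at scale [1/n] at the ends,
    [phi' = O(n)] and [f = O(1/n)] where [phi' <> 0], so [phi' f] stays bounded
    on a set of measure [O(1/n)]: the last term disappears in the limit and
    [Re <w, f>] is a limit of nonnegative numbers ([cut_energy_cvg]). Nothing
    has to be cut off at infinity on a lead, because [phi'] and [phi''] have
    bounded support there.

    In the maximal domain [f'] is only required to be the derivative of [f]
    almost everywhere, whereas the computation needs it everywhere in the
    interior of an edge. As [f'] is itself continuous, this follows from a mean
    value inequality for absolutely continuous functions ([ac_mean_value]). *)

(** * Absolute continuity and the mean value inequality *)

Section AbsoluteContinuity.
Context (R : realType).
Local Notation mu := (@lebesgue_measure R).
Implicit Types (g h : R -> R) (a b x y d : R).

Lemma ae_imp (P P' : R -> Prop) : (forall x, P x -> P' x) ->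
  {ae mu, forall x, P x} -> {ae mu, forall x, P' x}.
Proof. exact: (@filterS _ _ (ae_filter_ringOfSetsType mu)). Qed.

Lemma ae_imp2 (P P' P'' : R -> Prop) : (forall x, P x -> P' x -> P'' x) ->
  {ae mu, forall x, P x} -> {ae mu, forall x, P' x} -> {ae mu, forall x, P'' x}.
Proof. exact: (@filterS2 _ _ (ae_filter_ringOfSetsType mu)). Qed.

(** The form of differentiability used for estimates: the first-order error is
    eventually below any multiple of the increment. *)
Lemma is_derive_nearP g x d : is_derive x 1 g d <->
  forall e, 0 < e -> \forall y \near x, `|g y - g x - d * (y - x)| <= e * `|y - x|.
Proof.
split=> [[dg dE] e e0|H].
- move/cvg_ex : (dg) => [l gl].
  have ld : l = d by rewrite -dE; apply/esym/cvg_lim.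
  move: gl; rewrite ld => /cvgrPdist_le/(_ e e0).
  rewrite near_withinE => /nbhs_ballP [r /= r0 rP].
  apply/nbhs_ballP; exists r => //= y xy.
  have [->|yx] := eqVneq y x; first by rewrite !subrr mulr0 subr0 !normr0 mulr0.
  have yx0 : y - x != 0 by rewrite subr_eq0.
  have := rP (y - x); rewrite /ball/= sub0r normrN distrC => /(_ xy yx0).
  rewrite /GRing.scale/= mulr1 subrK => le_e.
  have -> : g y - g x - d * (y - x) =
      - ((d - (y - x)^-1 * (g y - g x)) * (y - x)).
    by field.
  by rewrite normrN normrM (distrC x y) ler_wpM2r.
- have cv : h^-1 *: (g (h *: 1 + x) - g x) @[h --> 0^'] --> d.
    apply/cvgrPdist_le => e e0.
    rewrite near_withinE.
    move: (H e e0) => /nbhs_ballP [r /= r0 rP].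
    apply/nbhs_ballP; exists r => //= t; rewrite /ball/= sub0r normrN => tr t0.
    have := rP (t + x); rewrite /ball/= opprD addrCA subrr addr0 normrN => /(_ tr).
    rewrite /GRing.scale/= mulr1 addrK => le_e.
    have -> : d - t^-1 * (g (t + x) - g x) =
        - (t^-1 * (g (t + x) - g x - d * t)) by field.
    by rewrite normrN normrM normrV ?unitfE// mulrC ler_pdivrMr ?normr_gt0.
  split; first by apply/cvg_ex; exists d.
  exact: cvg_lim.
Qed.

(** Absolute continuity for a list of intervals written from right to left, the
    shape produced by extending a covering one interval at a time. *)
Lemma abs_continuous_seq a b g e : abs_continuous a b g -> 0 < e ->
  exists2 d, 0 < d & forall s : seq (R * R),
    (forall p, p \in s -> [/\ a <= p.1, p.1 <= p.2 & p.2 <= b]) ->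
    pairwise (fun p q => q.2 <= p.1) s ->
    \sum_(p <- s) (p.2 - p.1) < d -> \sum_(p <- s) `|g p.2 - g p.1| < e.
Proof.
move=> ac e0; have [d d0 dP] := ac _ e0; exists d => // s sab /pairwiseP pws sd.
have sE (F : R * R -> R) :
    \sum_(p <- s) F p = \sum_(i < size s) F (nth (0, 0) s i).
  by rewrite (big_nth (0, 0)) big_mkord.
rewrite sE; rewrite sE in sd; move: sd.
apply: (dP _ (fun i => (nth (0, 0) s i).1) (fun i => (nth (0, 0) s i).2)).
- by move=> i; apply: sab; rewrite mem_nth.
- move=> i j ij; have [lt|lt|/val_inj eq] := ltngtP i j.
  + by right; apply: (pws (0, 0)) => //; rewrite inE.
  + by left; apply: (pws (0, 0)) => //; rewrite inE.
  + by rewrite eq eqxx in ij.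
Qed.

(** The derivative is controlled off a null set only. Enclose that null set in an
    open set [U] of small measure and walk from [a] to [b]: at a point of the
    null set a step stays inside [U], where absolute continuity bounds the total
    variation of all such steps; at any other point a step is controlled by the
    derivative. That the walk reaches [b] is Cousin's lemma, proved by taking
    the supremum of the reachable points. *)
Lemma ac_mean_value a b g M : a <= b -> 0 <= M -> abs_continuous a b g ->
  {ae mu, forall x, `[a, b]%classic x ->
     exists2 d, is_derive x 1 g d & `|d| <= M} ->
  `|g b - g a| <= M * (b - a).
Proof.
move=> ab M0 ac [A [mA A0 sA]].
apply/ler_addgt0Pr => e e0.
have e20 : 0 < e / 2 by rewrite divr_gt0.
have [del del0 delP] := abs_continuous_seq ac e20.
have A_fin : (mu A < +oo)%E by rewrite [ltLHS]A0.
have [U [oU AU mUA]] := lebesgue_regularity_outer mA A_fin del0.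
have mU : measurable U by exact: open_measurable.
have mU' : (mu U < del%:E)%E.
  have mUDA : measurable (U `\` A) by exact: measurableD.
  have -> : mu U = (mu A + mu (U `\` A))%E.
    rewrite -[in LHS](setDUK AU); apply: measureU => //.
    by rewrite setDE setICA setICr setI0.
  by rewrite A0 add0e.
(* Half of the error is spent on the steps in [U], half on the others; the
   [+ 1] only guards against [a = b]. *)
pose eta := e / 2 / (b - a + 1).
have ba1 : 0 < b - a + 1 by rewrite ltr_wpDl// subr_ge0.
have eta0 : 0 < eta by rewrite divr_gt0.
(* [P c]: the walk can reach [c], and [s] lists its steps inside [U]. *)
pose P c := exists s : seq (R * R), [/\
  forall p, p \in s -> [/\ a <= p.1, p.1 <= p.2 & p.2 <= c],
  pairwise (fun p q => q.2 <= p.1) s,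
  ((\sum_(p <- s) (p.2 - p.1))%:E <= mu (U `&` `[a, c]))%E &
  `|g c - g a| <= (M + eta) * (c - a) + \sum_(p <- s) `|g p.2 - g p.1|].
have Pa : P a.
  by exists [::]; split => //; rewrite !big_nil ?subrr ?normr0 ?mulr0 ?addr0.
have step x : a <= x <= b -> exists2 r, 0 < r & forall c y,
    a <= c -> x - r < c -> c <= x -> x <= y -> y < x + r -> P c -> P y.
  move=> /andP[ax xb]; have [Ax|nAx] := pselect (A x).
  - have /nbhs_ballP[r /= r0 rU] : nbhs x U by apply: open_nbhs_nbhs; split => //; exact: AU.
    exists r => // c y ac' xc cx xy yr [s [s1 s2 s3 s4]].
    exists ((c, y) :: s); split.
    + move=> p; rewrite inE => /predU1P[->/=|/s1 [? ? pc]]; split=> //.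
      * exact: le_trans xy.
      * by apply: (le_trans pc); exact: le_trans xy.
    + by rewrite /= s2 andbT; apply/allP => p /s1 [].
    + rewrite big_cons EFinD/=.
      have -> : U `&` `[a, y] = (U `&` `[a, c]) `|` `]c, y].
        rewrite eqEsubset; split => t /=; rewrite !in_itv/=.
          move=> [Ut /andP[at' ty]]; have [tc|ct] := leP t c; [left|right] => //.
            by rewrite at'.
        move=> [[Ut /andP[at' tc]]|/andP[ct ty]].
          by split=> //; rewrite at' (le_trans tc)// (le_trans cx).
        split; last by rewrite ty (le_trans ac')// ltW.
        apply: rU; rewrite /ball/=; rewrite ltr_norml; apply/andP; split; lra.
      have cyE : mu `]c, y] = (y - c)%:E.
        rewrite lebesgue_measure_itv/= lte_fin.
        by have [//|yc] := ltP c y; congr EFin; lra.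
      have -> : mu ((U `&` `[a, c]) `|` `]c, y]) =
          (mu (U `&` `[a, c]) + mu `]c, y])%E.
        apply: measureU => //; first exact: measurableI.
        rewrite -subset0 => t /= [[_]]; rewrite !in_itv/= => /andP[_ tc] /andP[ct _].
        by move: (lt_le_trans ct tc); rewrite ltxx.
      by rewrite addeC leeD// cyE.
    + rewrite big_cons/=.
      have : `|g y - g a| <= `|g y - g c| + `|g c - g a|.
        by rewrite (le_trans _ (ler_normD _ _))// addrA subrK.
      have : (M + eta) * (c - a) <= (M + eta) * (y - a).
        apply: ler_wpM2l; first by rewrite addr_ge0// ltW.
        by rewrite lerD2r (le_trans cx).
      lra.
  - have [d dg dM] : exists2 d, is_derive x 1 g d & `|d| <= M.
      apply: contrapT => nd; apply: nAx; apply: sA => /=.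
      by move/(_ _) => H; apply: nd; apply: H; rewrite in_itv/= ax.
    have /nbhs_ballP[r /= r0 rP] := (is_derive_nearP g x d).1 dg eta eta0.
    exists r => // c y ac' xc cx xy yr [s [s1 s2 s3 s4]].
    have cy : c <= y by exact: le_trans xy.
    exists s; split => //.
    + by move=> p /s1 [? ? pc]; split => //; exact: le_trans cy.
    + apply: (le_trans s3); apply: le_measure; rewrite ?inE.
      * exact: measurableI.
      * exact: measurableI.
      * by apply: setIS; apply: subset_itvl; rewrite bnd_simp.
    + have bnd t : ball x r t -> `|g t - g x| <= (M + eta) * `|t - x|.
        move=> /rP H.
        have -> : g t - g x = (g t - g x - d * (t - x)) + d * (t - x) by ring.
        rewrite (le_trans (ler_normD _ _))// mulrDl addrC lerD// normrM.
        by rewrite ler_wpM2r.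
      have By : ball x r y by rewrite /ball/= ltr_norml; apply/andP; split; lra.
      have Bc : ball x r c by rewrite /ball/= ltr_norml; apply/andP; split; lra.
      have := bnd _ By; have := bnd _ Bc.
      rewrite (ger0_norm (_ : 0 <= y - x)) ?subr_ge0//.
      rewrite (ler0_norm (_ : c - x <= 0)) ?subr_le0// opprB distrC => H1 H2.
      have : `|g y - g a| <= `|g y - g x| + `|g x - g c| + `|g c - g a|.
        have -> : g y - g a = (g y - g x) + (g x - g c) + (g c - g a) by ring.
        by rewrite (le_trans (ler_normD _ _))// lerD2r ler_normD.
      lra.
pose S := [set c | a <= c <= b /\ P c].
have hS : has_sup S.
  split; first by exists a; split => //; rewrite lexx.
  by exists b => c [/andP[]].
have Sa : S a by split => //; rewrite lexx.
have az : a <= sup S by exact: (ub_le_sup hS.2).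
have zb : sup S <= b by apply: (ge_sup hS.1) => c [/andP[]].
have [|r r0 rP] := step (sup S); first by rewrite az.
have [c [/andP[ac' cb] Pc] xc] := sup_adherent r0 hS.
have cz : c <= sup S by apply: (ub_le_sup hS.2); split => //; rewrite ac'.
have zbE : sup S = b.
  apply/eqP; rewrite eq_le zb/= leNgt; apply/negP => zltb.
  pose y := Num.min b (sup S + r / 2).
  have zy : sup S < y by rewrite lt_min zltb/= ltrDl divr_gt0.
  have : y <= sup S.
    apply: (ub_le_sup hS.2); split.
      by rewrite (le_trans az (ltW zy))/= ge_min lexx.
    apply: (rP c) => //; first exact: ltW.
    by rewrite gt_min; apply/orP; right; lra.
  by rewrite leNgt zy.
have [s [s1 s2 s3 s4]] : P b.
  by apply: (rP c) => //; rewrite zbE// ltrDl.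
have {}s3 : \sum_(p <- s) (p.2 - p.1) < del.
  rewrite -lte_fin (le_lt_trans s3)// (le_lt_trans _ mU')//.
  apply: le_measure; rewrite ?inE//.
  exact: measurableI.
have := delP s s1 s2 s3.
have : eta * (b - a) <= e / 2.
  by rewrite /eta mulrAC ler_pdivrMr// ler_wpM2l ?ltW// ltrDl.
lra.
Qed.

End AbsoluteContinuity.

Section AbsoluteContinuityCalculus.
Context (R : realType).
Local Notation mu := (@lebesgue_measure R).
Implicit Types (g h : R -> R) (a b x y d : R).

Lemma abs_continuousS a b c d g : a <= c -> d <= b ->
  abs_continuous a b g -> abs_continuous c d g.
Proof.
move=> ac db acg e e0; have [del del0 H] := acg e e0; exists del => // n s t sP.
by apply: H => i; have [cs st td] := sP i; split=> //; [exact: le_trans cs|exact: le_trans db].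
Qed.

Lemma abs_continuous_unif a b g e : abs_continuous a b g -> 0 < e ->
  exists2 d, 0 < d & forall x y, a <= x <= b -> a <= y <= b -> `|x - y| < d ->
    `|g x - g y| < e.
Proof.
move=> acg e0; have [d d0 H] := acg e e0; exists d => // x y.
wlog xy : x y / x <= y => [W|/andP[ax _] /andP[_ yb]].
  move=> hx hy; have [xy|/ltW yx] := leP x y; first exact: W.
  by rewrite (distrC x) (distrC (g x)); exact: W.
rewrite (distrC x) (distrC (g x)) (ger0_norm (_ : 0 <= y - x)) ?subr_ge0// => xyd.
have := H 1%N (fun=> x) (fun=> y); rewrite !big_ord1; apply => // i j.
by rewrite !ord1 eqxx.
Qed.

Lemma abs_continuous_within a b g : a < b -> abs_continuous a b g ->
  {within `[a, b], continuous g}.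
Proof.
move=> ab acg; apply/continuous_within_itvP => //; split.
- move=> x /[!in_itv]/= /andP[ax xb]; apply/cvgrPdist_lt => e e0.
  have [d d0 H] := abs_continuous_unif acg e0.
  have /cvgrPdist_lt/(_ d d0) nd : y @[y --> x] --> x by exact: cvg_id.
  near=> y; apply: H.
  + by rewrite !ltW.
  + apply/andP; split; apply: ltW; near: y.
    * exact: lt_nbhsr.
    * exact: lt_nbhsl.
  + near: y; exact: nd.
- apply/cvgrPdist_lt => e e0.
  have [d d0 H] := abs_continuous_unif acg e0.
  have /cvgrPdist_lt/(_ d d0) nd : y @[y --> a^'+] --> a by exact: cvg_at_right_filter.
  near=> y; apply: H; first by rewrite lexx ltW.
  + apply/andP; split; apply: ltW; near: y; first exact: nbhs_right_gt.
    exact: nbhs_right_lt.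
  + by near: y; exact: nd.
- apply/cvgrPdist_lt => e e0.
  have [d d0 H] := abs_continuous_unif acg e0.
  have /cvgrPdist_lt/(_ d d0) nd : y @[y --> b^'-] --> b by exact: cvg_at_left_filter.
  near=> y; apply: H; first by rewrite lexx ltW.
  + apply/andP; split; apply: ltW; near: y; first exact: nbhs_left_gt.
    exact: nbhs_left_lt.
  + by near: y; exact: nd.
Unshelve. all: by end_near. Qed.

Lemma abs_continuous_bounded a b g : a <= b -> abs_continuous a b g ->
  exists2 K, 0 <= K & forall x, a <= x <= b -> `|g x| <= K.
Proof.
rewrite le_eqVlt => /predU1P[<- _|ab acg].
  by exists `|g a| => // x /andP[ax xa]; rewrite (@le_anti _ _ x a)// ax xa.
have cg := abs_continuous_within ab acg.
have [c1 _ H1] := EVT_max (ltW ab) cg; have [c2 _ H2] := EVT_min (ltW ab) cg.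
exists (`|g c1| + `|g c2|) => [|x xab]; first by rewrite addr_ge0.
have := H1 x; have := H2 x; rewrite in_itv/= => /(_ xab) l /(_ xab) u.
rewrite ler_norml; apply/andP; split.
- have := ler_norm (- g c2); rewrite normrN; have := normr_ge0 (g c1); lra.
- have := ler_norm (g c1); have := normr_ge0 (g c2); lra.
Qed.

(** Sums, products and Lipschitz functions are all handled by dominating the
    increments of a function by those of two absolutely continuous ones. *)
Lemma abs_continuous_dominated a b g h k K L :
  abs_continuous a b g -> abs_continuous a b h -> 0 <= K -> 0 <= L ->
  (forall s t, a <= s -> s <= t -> t <= b ->
    `|k t - k s| <= K * `|g t - g s| + L * `|h t - h s|) ->
  abs_continuous a b k.
Proof.
move=> acg ach K0 L0 H e e0.
have eK : 0 < e / 2 / (K + 1) by rewrite !divr_gt0// ltr_wpDl.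
have eL : 0 < e / 2 / (L + 1) by rewrite !divr_gt0// ltr_wpDl.
have [d1 d10 H1] := acg _ eK; have [d2 d20 H2] := ach _ eL.
exists (Num.min d1 d2) => [|n s t sP st]; first by rewrite lt_min d10.
rewrite lt_min => /andP[/(H1 _ _ _ sP st) l1 /(H2 _ _ _ sP st) l2].
have le1 : \sum_i `|k (t i) - k (s i)| <=
    K * (\sum_i `|g (t i) - g (s i)|) + L * (\sum_i `|h (t i) - h (s i)|).
  rewrite !mulr_sumr -big_split; apply: ler_sum => i _ /=.
  by have [? ? ?] := sP i; exact: H.
apply: (le_lt_trans le1).
move: l1 l2; rewrite !ltr_pdivlMr ?ltr_wpDl//.
set u := \sum_i _; set v := \sum_i _.
have u0 : 0 <= u by apply: sumr_ge0.
have v0 : 0 <= v by apply: sumr_ge0.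
by rewrite !mulrDr !mulr1 ![_ * K]mulrC ![_ * L]mulrC; lra.
Qed.

Lemma abs_continuous_lipschitz a b k K : 0 <= K ->
  (forall s t, a <= s -> s <= t -> t <= b -> `|k t - k s| <= K * (t - s)) ->
  abs_continuous a b k.
Proof.
move=> K0 H.
have acid : abs_continuous a b id.
  move=> e e0; exists e => // n s t sP _ st_e.
  rewrite (eq_bigr (fun i => t i - s i))// => i _.
  by have [_ st _] := sP i; rewrite ger0_norm ?subr_ge0.
apply: (abs_continuous_dominated acid acid K0 (lexx 0)) => s t sa st tb.
by rewrite mul0r addr0 (ger0_norm (_ : 0 <= t - s)) ?subr_ge0//; exact: H.
Qed.

Lemma abs_continuousD a b g h : abs_continuous a b g -> abs_continuous a b h ->
  abs_continuous a b (fun x => g x + h x).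
Proof.
move=> acg ach; apply: (abs_continuous_dominated acg ach ler01 ler01) => s t _ _ _.
by rewrite !mul1r opprD addrACA; exact: ler_normD.
Qed.

Lemma abs_continuousM a b g h : a <= b ->
  abs_continuous a b g -> abs_continuous a b h ->
  abs_continuous a b (fun x => g x * h x).
Proof.
move=> ab acg ach.
have [K K0 gK] := abs_continuous_bounded ab acg.
have [L L0 hL] := abs_continuous_bounded ab ach.
apply: (abs_continuous_dominated acg ach L0 K0) => s t sa st tb.
have -> : g t * h t - g s * h s = h t * (g t - g s) + g s * (h t - h s) by ring.
rewrite (le_trans (ler_normD _ _))// !normrM lerD// ler_wpM2r//.
- by apply: hL; rewrite tb (le_trans sa).
- by apply: gK; rewrite sa (le_trans st).
Qed.

Lemma abs_continuous_scale a b c g : abs_continuous a b g ->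
  abs_continuous a b (fun x => c * g x).
Proof.
move=> acg; apply: (abs_continuous_dominated acg acg (normr_ge0 c) (lexx 0)).
by move=> s t _ _ _; rewrite mul0r addr0 -normrM mulrBr.
Qed.

Lemma abs_continuous_at x r g : 0 < r -> abs_continuous (x - r) (x + r) g ->
  {for x, continuous g}.
Proof.
move=> r0 acg; have lt : x - r < x + r by lra.
have /(continuous_within_itvP _ lt)[H _ _] := abs_continuous_within lt acg.
by apply: H; rewrite in_itv/= ltrBlDr ltrDl r0.
Qed.

(** Subtracting the tangent of slope [h x] from [g] leaves a function whose
    derivative is almost everywhere small near [x], so the mean value inequality
    applies to it. *)
Lemma ac_is_derive x r g h : 0 < r ->
  abs_continuous (x - r) (x + r) g -> {for x, continuous h} ->
  {ae mu, forall y, `[x - r, x + r]%classic y -> is_derive y 1 g (h y)} ->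
  is_derive x 1 g (h x).
Proof.
move=> r0 acg ch aeg; apply/is_derive_nearP => e e0.
have /cvgrPdist_le/(_ e e0)/nbhs_ballP[d /= d0 dP] := ch.
pose k t := g t + (- h x) * t.
have kM a b : a <= b -> x - r <= a -> b <= x + r -> x - d < a -> b < x + d ->
    `|k b - k a| <= e * (b - a).
  move=> ab ra br da bd; apply: ac_mean_value => //; first exact: ltW.
    apply: abs_continuousD; first exact: abs_continuousS acg.
    apply: abs_continuous_scale; apply: (@abs_continuous_lipschitz _ _ _ 1) => // s t _ st _.
    by rewrite mul1r ger0_norm// subr_ge0.
  apply: ae_imp aeg => y H /=; rewrite in_itv/= => /andP[ay yb].
  have dy : is_derive y 1 g (h y).
    by apply: H => /=; rewrite in_itv/= (le_trans ra)//= (le_trans yb).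
  exists (h y + (- h x) *: 1); first by apply: is_deriveD.
  rewrite /GRing.scale/= mulr1 distrC; apply: dP.
  by rewrite /ball/= ltr_norml; apply/andP; split; lra.
apply/nbhs_ballP; exists (Num.min d r) => [/=|y]; first by rewrite lt_min d0.
rewrite /ball/= lt_min !ltr_norml => /andP[/andP[h1 h2] /andP[h3 h4]].
have -> : g y - g x - h x * (y - x) = k y - k x by rewrite /k; ring.
have [xy|/ltW yx] := leP x y.
- by rewrite (ger0_norm (_ : 0 <= y - x)) ?subr_ge0//; apply: kM => //; lra.
- rewrite distrC (distrC y) (ger0_norm (_ : 0 <= x - y)) ?subr_ge0//.
  by apply: kM => //; lra.
Qed.

Lemma AC_locD (D : set R) g h : AC_loc D g -> AC_loc D h ->
  AC_loc D (fun x => g x + h x).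
Proof. by move=> acg ach a b ab sub; apply: abs_continuousD; [exact: acg|exact: ach]. Qed.

Lemma AC_locZ (D : set R) c g : AC_loc D g -> AC_loc D (fun x => c * g x).
Proof. by move=> acg a b ab sub; apply: abs_continuous_scale; exact: acg. Qed.

End AbsoluteContinuityCalculus.

(** * A cutoff vanishing at the ends of an edge *)

Section Cutoff.
Context (R : realType).
Implicit Types (t x nu : R) (r : option R).

(** Handles at once the two sides of the kink of [ramp], and the kink itself. *)
Lemma is_derive_quadratic (g : R -> R) x d K : 0 <= K ->
  (forall y, `|y - x| <= 1 -> `|g y - g x - d * (y - x)| <= K * (y - x) ^+ 2) ->
  is_derive x 1 g d.
Proof.
move=> K0 H; apply/is_derive_nearP => e e0.
have K1 : 0 < K + 1 by rewrite ltr_wpDl.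
apply/nbhs_ballP; exists (Num.min 1 (e / (K + 1))) => /= [|y].
  by rewrite lt_min ltr01 divr_gt0.
rewrite /ball/= lt_min distrC => /andP[y1]; rewrite ltr_pdivlMr// => ye.
rewrite (le_trans (H y (ltW y1)))// -(@real_normK _ (y - x)) ?num_real//.
rewrite expr2 mulrA ler_wpM2r//.
by have := normr_ge0 (y - x); nra.
Qed.

Definition ramp t : R := Num.max (1 - t) 0.

Lemma ramp_ge0 t : 0 <= ramp t. Proof. by rewrite le_max lexx orbT. Qed.

Lemma ramp_le1 t : 0 <= t -> ramp t <= 1.
Proof. by move=> t0; rewrite ge_max ler01 andbT lerBlDr lerDl. Qed.

Lemma ramp0 t : 1 <= t -> ramp t = 0.
Proof. by move=> t1; apply/max_idPr; rewrite subr_le0. Qed.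

Lemma rampE t : t <= 1 -> ramp t = 1 - t.
Proof. by move=> t1; apply/max_idPl; rewrite subr_ge0. Qed.

Lemma ramp_lipschitz t s : `|ramp t - ramp s| <= `|t - s|.
Proof.
have [t1|/ltW t1] := leP t 1; have [s1|/ltW s1] := leP s 1;
  rewrite ?(rampE t1) ?(rampE s1) ?(ramp0 t1) ?(ramp0 s1).
- by rewrite distrC (_ : _ - _ = t - s)//; ring.
- by rewrite subr0 ger0_norm ?subr_ge0// distrC ger0_norm ?subr_ge0; lra.
- by rewrite sub0r normrN ger0_norm ?subr_ge0// ger0_norm ?subr_ge0; lra.
- by rewrite subrr normr0.
Qed.

Lemma continuous_ramp : continuous ramp.
Proof.
move=> t; apply/cvgrPdist_le => e e0; apply/nbhs_ballP; exists e => //= s.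
by rewrite /ball/= => /ltW; apply: le_trans; exact: ramp_lipschitz.
Qed.

Lemma is_derive_ramp2 t : is_derive t 1 (fun s => ramp s ^+ 2) (- 2 * ramp t).
Proof.
apply: (@is_derive_quadratic _ _ _ 2) => // s _.
have [t1|/ltW t1] := leP t 1; have [s1|/ltW s1] := leP s 1;
  rewrite ?(rampE t1) ?(rampE s1) ?(ramp0 t1) ?(ramp0 s1).
- have -> : (1 - s) ^+ 2 - (1 - t) ^+ 2 - - 2 * (1 - t) * (s - t) = (s - t) ^+ 2 by ring.
  by rewrite ger0_norm ?sqr_ge0//; have := sqr_ge0 (s - t); lra.
- have -> : 0 ^+ 2 - (1 - t) ^+ 2 - - 2 * (1 - t) * (s - t) =
     (1 - t) * ((1 - t) + 2 * (s - 1)) by ring.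
  by rewrite ger0_norm; nra.
- by rewrite expr0n/= subr0 mulr0 mul0r subr0 ger0_norm ?sqr_ge0//; nra.
- by rewrite mulr0 mul0r !subr0 subrr normr0 mulr_ge0// sqr_ge0.
Qed.

Lemma is_derive_ramp3 t : is_derive t 1 (fun s => ramp s ^+ 3) (- 3 * ramp t ^+ 2).
Proof.
apply: (@is_derive_quadratic _ _ _ (3 * ramp t + 3)) => [|s].
  by rewrite addr_ge0// mulr_ge0// ramp_ge0.
have [t1|/ltW t1] := leP t 1; have [s1|/ltW s1] := leP s 1;
  rewrite ?(rampE t1) ?(rampE s1) ?(ramp0 t1) ?(ramp0 s1) ler_norml => /andP[l1 l2].
- have -> : (1 - s) ^+ 3 - (1 - t) ^+ 3 - - 3 * (1 - t) ^+ 2 * (s - t) =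
    (3 * (1 - t) - (s - t)) * (s - t) ^+ 2 by ring.
  rewrite normrM (ger0_norm (sqr_ge0 _)) ler_wpM2r ?sqr_ge0//.
  by rewrite ler_norml; apply/andP; split; lra.
- have -> : 0 ^+ 3 - (1 - t) ^+ 3 - - 3 * (1 - t) ^+ 2 * (s - t) =
     (1 - t) ^+ 2 * (3 * (s - t) - (1 - t)) by ring.
  rewrite normrM (ger0_norm (sqr_ge0 _)) mulrC ler_pM ?sqr_ge0//.
  + by rewrite ler_norml; apply/andP; split; lra.
  + by rewrite ler_pXn2r ?nnegrE//; lra.
- have -> : (1 - s) ^+ 3 - 0 ^+ 3 - - 3 * 0 ^+ 2 * (s - t) = (1 - s) * (1 - s) ^+ 2 :> R.
    by ring.
  rewrite ger0_norm ?mulr_ge0 ?sqr_ge0 ?subr_ge0// ler_pM ?sqr_ge0 ?subr_ge0//; first lra.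
  rewrite -[leRHS]sqrrN.
  by rewrite ler_pXn2r ?nnegrE//; lra.
- have -> : 0 ^+ 3 - 0 ^+ 3 - - 3 * 0 ^+ 2 * (s - t) = 0 :> R by ring.
  by rewrite normr0 mulr0 add0r mulr_ge0// sqr_ge0.
Qed.

(** An edge is encoded by its right end: [None] for a lead, [Some l] for a finite
    edge of length [l]. *)
Definition edge_of r : interval R :=
  if r is Some l then `]0, l[ else `[0, +oo[.

(** Cutoffs act inside [`]0, edge_span r[] only. On a lead any positive number
    would do. *)
Definition edge_span r : R := if r is Some l then l else 1.

(** Distance to the nearest finite end; it is positive exactly in the interior. *)
Definition edge_dist r x : R := if r is Some l then Num.min x (l - x) else x.

(** The cube makes the cutoff twice continuously differentiable. *)
Definition cut r nu x : R :=
  1 - ramp (nu * x) ^+ 3 - (if r is Some l then ramp (nu * (l - x)) ^+ 3 else 0).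

Definition cut1 r nu x : R := 3 * nu * ramp (nu * x) ^+ 2 -
  (if r is Some l then 3 * nu * ramp (nu * (l - x)) ^+ 2 else 0).

Definition cut2 r nu x : R := - 6 * nu ^+ 2 * ramp (nu * x) -
  (if r is Some l then 6 * nu ^+ 2 * ramp (nu * (l - x)) else 0).

Lemma is_derive_chain (f : R -> R) x (a b d : R) :
  is_derive (a * x + b) 1 f d -> is_derive x 1 (fun y => f (a * y + b)) (a * d).
Proof.
move=> df; have da : is_derive x 1 (fun y => a * y + b) a.
  have H : is_derive x 1 ((fun y => a *: y) + cst b) (a *: 1 + 0) by apply: is_deriveD.
  by rewrite -[X in is_derive _ _ _ X](_ : a *: 1 + 0 = a)//= /GRing.scale/= mulr1 addr0.
have := @is_derive1_comp _ f (fun y => a * y + b) x d a df da.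
by rewrite /GRing.scale/= mulrC.
Qed.

Lemma is_derive_cut r nu x : is_derive x 1 (cut r nu) (cut1 r nu x).
Proof.
have d1 : is_derive x 1 (fun y => ramp (nu * y) ^+ 3) (nu * (- 3 * ramp (nu * x) ^+ 2)).
  have := @is_derive_chain (fun t => ramp t ^+ 3) x nu 0 _ (is_derive_ramp3 _).
  by under eq_fun do rewrite addr0; rewrite addr0.
case: r => [l|].
- have d2 : is_derive x 1 (fun y => ramp (nu * (l - y)) ^+ 3)
     (- nu * (- 3 * ramp (nu * (l - x)) ^+ 2)).
    have := @is_derive_chain (fun t => ramp t ^+ 3) x (- nu) (nu * l) _ (is_derive_ramp3 _).
    rewrite (_ : - nu * x + nu * l = nu * (l - x)); last by ring.
    by congr is_derive; apply/funext => y; congr (ramp _ ^+ 3); ring.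
  have H := is_deriveB (is_deriveB (is_derive_cst (1 : R) x 1) d1) d2.
  by apply: is_derive_eq; rewrite /cut1; ring.
- have H := is_deriveB (is_deriveB (is_derive_cst (1 : R) x 1) d1) (is_derive_cst (0 : R) x 1).
  by apply: is_derive_eq; rewrite /cut1; ring.
Qed.

Lemma is_derive_cut1 r nu x : is_derive x 1 (cut1 r nu) (cut2 r nu x).
Proof.
have d1 : is_derive x 1 (fun y => ramp (nu * y) ^+ 2) (nu * (- 2 * ramp (nu * x))).
  have := @is_derive_chain (fun t => ramp t ^+ 2) x nu 0 _ (is_derive_ramp2 _).
  by under eq_fun do rewrite addr0; rewrite addr0.
case: r => [l|].
- have d2 : is_derive x 1 (fun y => ramp (nu * (l - y)) ^+ 2)
     (- nu * (- 2 * ramp (nu * (l - x)))).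
    have := @is_derive_chain (fun t => ramp t ^+ 2) x (- nu) (nu * l) _ (is_derive_ramp2 _).
    rewrite (_ : - nu * x + nu * l = nu * (l - x)); last by ring.
    by congr is_derive; apply/funext => y; congr (ramp _ ^+ 2); ring.
  have H := is_deriveB (is_deriveZ (3 * nu) d1) (is_deriveZ (3 * nu) d2).
  by apply: is_derive_eq; rewrite /cut2 /GRing.scale/=; ring.
- have H := is_deriveB (is_deriveZ (3 * nu) d1) (is_derive_cst (0 : R) x 1).
  by apply: is_derive_eq; rewrite /cut2 /GRing.scale/=; ring.
Qed.

Lemma continuous_cut2 r nu : continuous (cut2 r nu).
Proof.
have cr (f : R -> R) : continuous f -> continuous (fun x => ramp (f x)).
  by move=> cf x; apply: continuous_comp; [exact: cf|exact: continuous_ramp].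
have cM (a : R) (f : R -> R) : continuous f -> continuous (fun x => a * f x).
  by move=> cf x; apply: cvgM; [exact: cvg_cst|exact: cf].
have cI : continuous (id : R -> R) by move=> x; exact: cvg_id.
move=> x; apply: cvgB.
  exact: (cM _ _ (cr _ (cM _ _ cI))).
case: r => [l|]; last exact: cvg_cst.
have cl : continuous (fun x => l - x) by move=> y; apply: cvgB; [exact: cvg_cst|exact: cI].
exact: (cM _ _ (cr _ (cM _ _ cl))).
Qed.

(** At most one of the two ends is ever felt, so that the cutoff is a function
    of the distance to the nearest end. *)
Lemma cut_edge_dist r nu x : 1 <= nu -> 2 <= nu * edge_span r ->
  exists2 s : R, `|s| = 1 &
    [/\ cut r nu x = 1 - ramp (nu * edge_dist r x) ^+ 3,
        cut1 r nu x = s * (3 * nu * ramp (nu * edge_dist r x) ^+ 2) &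
        cut2 r nu x = - (6 * nu ^+ 2 * ramp (nu * edge_dist r x))].
Proof.
rewrite /cut /cut1 /cut2 /edge_span /edge_dist.
case: r => [l|] nu1 nul; last first.
  by exists 1; rewrite ?normr1//; split; ring.
have [xl|lx] := leP x (l - x).
- have r0 : ramp (nu * (l - x)) = 0 by apply: ramp0; nra.
  exists 1; rewrite ?normr1//; rewrite r0; split; rewrite ?expr0n/=; ring.
- have r0 : ramp (nu * x) = 0 by apply: ramp0; nra.
  exists (- 1); rewrite ?normrN1//; rewrite r0; split; rewrite ?expr0n/=; ring.
Qed.

Section CutBounds.
Context (r : option R) (nu x : R).
Hypotheses (nu1 : 1 <= nu) (nu_span : 2 <= nu * edge_span r).

Lemma cut_far : 1 <= nu * edge_dist r x ->
  [/\ cut r nu x = 1, cut1 r nu x = 0 & cut2 r nu x = 0].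
Proof.
move=> far; have [s _ [-> -> ->]] := cut_edge_dist x nu1 nu_span.
by rewrite ramp0// !expr0n/= subr0 !mulr0 oppr0.
Qed.

Lemma edge_dist_near : nu * edge_dist r x < 1 -> 0 < edge_dist r x ->
  edge_dist r x = Num.min x (edge_span r - x).
Proof.
move: nu_span; rewrite /edge_span /edge_dist; case: r => // nu2 near_x x0.
by apply/esym/min_idPl; nra.
Qed.

Lemma cut_bounds : 0 <= edge_dist r x ->
  [/\ `|cut r nu x| <= 1, `|cut r nu x| <= 3 * nu * edge_dist r x,
      `|cut1 r nu x| <= 3 * nu & `|cut2 r nu x| <= 6 * nu ^+ 2].
Proof.
move=> d0; have [s s1 [-> -> ->]] := cut_edge_dist x nu1 nu_span.
set t := nu * _; have t0 : 0 <= t by rewrite mulr_ge0// (le_trans ler01).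
have q0 := ramp_ge0 t; have q1 := ramp_le1 t0.
have q30 : 0 <= ramp t ^+ 3 by rewrite exprn_ge0.
have q31 : ramp t ^+ 3 <= 1 by rewrite exprn_ile1.
have q20 : 0 <= ramp t ^+ 2 by rewrite exprn_ge0.
have q21 : ramp t ^+ 2 <= 1 by rewrite exprn_ile1.
have nu0 : 0 <= nu by rewrite (le_trans ler01).
have nu20 : 0 <= nu ^+ 2 by rewrite sqr_ge0.
split.
- by rewrite ger0_norm ?subr_ge0// lerBlDr lerDl.
- rewrite ger0_norm ?subr_ge0// -mulrA -/t.
  have [t1|/ltW t1] := leP t 1; last by rewrite ramp0// expr0n/=; lra.
  rewrite rampE// -subr_ge0.
  have -> : 3 * t - (1 - (1 - t) ^+ 3) = t ^+ 2 * (3 - t) by ring.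
  by rewrite mulr_ge0 ?sqr_ge0//; lra.
- by rewrite normrM s1 mul1r ger0_norm ?mulr_ge0// ler_piMr ?mulr_ge0.
- by rewrite normrN ger0_norm ?mulr_ge0// ler_piMr ?mulr_ge0.
Qed.

End CutBounds.

End Cutoff.

(** * Integration on an edge *)

Section EdgeIntegrals.
Context (R : realType).
Local Notation mu := (@lebesgue_measure R).
Implicit Types (x : R) (r : option R) (f g h k w : R -> R).

(** The fundamental theorem of calculus on an open interval whose integrand and
    primitive are only controlled inside: both tend to [0] at the ends, so their
    extensions by [0] are continuous on the closed interval. *)
Lemma integral_derivative_vanishing (B M : R) (G g : R -> R) : 0 < B -> 0 <= M ->
  (forall x, 0 < x < B -> is_derive x 1 G (g x)) ->
  (forall x, 0 < x < B -> {for x, continuous g}) ->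
  (forall x, 0 < x < B -> `|G x| <= M * Num.min x (B - x)) ->
  (forall x, 0 < x < B -> `|g x| <= M * Num.min x (B - x)) ->
  \int[mu]_(x in `]0, B[) g x = 0.
Proof.
move=> B0 M0 dG cg GM gM.
(* The bound is monotone in the distance to the ends, so extending by zero
   keeps it valid on the whole line. *)
pose patch k x := if (0 < x) && (x < B) then k x else 0.
have patch_bound k : (forall x, 0 < x < B -> `|k x| <= M * Num.min x (B - x)) ->
    forall x, `|patch k x| <= M * Num.max 0 (Num.min x (B - x)).
  move=> kM x; rewrite /patch; case: ifPn => [xB|_].
    rewrite (le_trans (kM x xB))// ler_wpM2l// le_max lexx orbT//.
  by rewrite normr0 mulr_ge0// le_max lexx.
have near_patch k x : 0 < x < B -> \forall y \near x, patch k y = k y.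
  move=> /andP[x0 xB]; near=> y; rewrite /patch ifT//; apply/andP; split.
    by near: y; exact: lt_nbhsr.
  by near: y; exact: lt_nbhsl.
have M1 : 0 < M + 1 by rewrite ltr_wpDl.
have patch0 k : (forall x, 0 < x < B -> `|k x| <= M * Num.min x (B - x)) ->
    patch k x @[x --> 0^'+] --> patch k 0 /\ patch k x @[x --> B^'-] --> patch k B.
  move=> /patch_bound kM.
  have -> : patch k 0 = 0 by rewrite /patch ltxx.
  have -> : patch k B = 0 by rewrite /patch ltxx andbF.
  split.
  - apply/cvgrPdist_le => e e0; near=> x; rewrite sub0r normrN.
    apply: (le_trans (kM x)).
    have x0 : 0 < x by near: x; exact: nbhs_right_gt.
    have xe : x < e / (M + 1) by near: x; apply: nbhs_right_lt; rewrite divr_gt0.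
    have : Num.max 0 (Num.min x (B - x)) <= x by rewrite ge_max ltW//= ge_min lexx.
    move: xe; rewrite ltr_pdivlMr// => xe le.
    by rewrite (le_trans (ler_wpM2l M0 le))//; nra.
  - apply/cvgrPdist_le => e e0; near=> x; rewrite sub0r normrN.
    apply: (le_trans (kM x)).
    have xB : x < B by near: x; exact: nbhs_left_lt.
    have xe : B - e / (M + 1) < x.
      by near: x; apply: nbhs_left_gt; rewrite ltrBlDr ltrDl divr_gt0.
    have : Num.max 0 (Num.min x (B - x)) <= B - x.
      by rewrite ge_max subr_ge0 ltW//= ge_min lexx orbT.
    have : (B - x) < e / (M + 1) by lra.
    rewrite ltr_pdivlMr// => {}xe le.
    by rewrite (le_trans (ler_wpM2l M0 le))//; nra.
have pc : {within `[0, B], continuous (patch g)}.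
  apply/continuous_within_itvP => //; split; [|exact: (patch0 _ gM).1|exact: (patch0 _ gM).2].
  move=> x /[!in_itv]/= xB; have ng := near_patch g x xB.
  rewrite /continuous_at (nbhs_singleton ng).
  apply: cvg_trans (cg x xB); apply: near_eq_cvg.
  by near=> y; apply/esym; near: y; exact: ng.
have pD : derivable_oo_LRcontinuous (patch G) 0 B.
  split; [|exact: (patch0 _ GM).1|exact: (patch0 _ GM).2].
  move=> x /[!in_itv]/= xB.
  have : derivable G x 1 by have [] := dG x xB.
  apply: near_eq_derivable.
  by near=> y; apply/esym; near: y; exact: near_patch.
have pE : {in `]0, B[, (patch G)^`()%classic =1 patch g}.
  move=> x /[!in_itv]/= xB; rewrite derive1E (nbhs_singleton (near_patch g x xB)).
  rewrite -(@near_eq_derive _ _ _ G _ _ 1).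
  - by have [_ ->] := dG x xB.
  - by near=> y; apply/esym; near: y; exact: near_patch.
have FTC := continuous_FTC2 B0 pc pD pE.
have pi : mu.-integrable `[0, B] (EFin \o patch g).
  by apply: continuous_compact_integrable => //; exact: segment_compact.
have sub : `]0, B[%classic `<=` `[0, B]%classic.
  by apply: subset_itvScc; rewrite bnd_simp.
transitivity (\int[mu]_(x in `]0, B[) patch g x).
  by apply: eq_Rintegral => x; rewrite inE/= in_itv/= /patch => ->.
rewrite Rintegral_itv_bndo_bndc; last first.
  by apply: integrableS pi.
rewrite Rintegral_itv_obnd_cbnd; last first.
  by apply: integrableS pi => //; apply: subset_itvScc; rewrite bnd_simp.
by rewrite /Rintegral FTC /patch !ltxx andbF/= subr0.
Unshelve. all: by end_near. Qed.

Lemma integrable_realD (D : set R) f g : measurable D ->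
  mu.-integrable D (EFin \o f) -> mu.-integrable D (EFin \o g) ->
  mu.-integrable D (EFin \o (fun x => f x + g x)).
Proof. by move=> mD fi gi; exact: (@integrableD _ _ R mu D mD _ _ fi gi). Qed.

Lemma integrable_realZ (D : set R) (c : R) f : measurable D ->
  mu.-integrable D (EFin \o f) -> mu.-integrable D (EFin \o (fun x => c * f x)).
Proof. by move=> mD fi; exact: (@integrableZl _ _ R mu D mD c _ fi). Qed.

Lemma sq_integrable_sqr (D : set R) f : measurable D -> sq_integrable D f ->
  mu.-integrable D (EFin \o (fun x => f x ^+ 2)).
Proof.
move=> mD [mf fi]; apply/integrableP; split.
  by apply/measurable_EFinP; exact: measurable_funX.
suff -> : (\int[mu]_(x in D) `|(EFin \o (fun x => f x ^+ 2)%R) x| =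
  \int[mu]_(x in D) (f x ^+ 2)%:E)%E by [].
by apply: eq_integral => x _ /=; rewrite ger0_norm ?sqr_ge0.
Qed.

Lemma integrable_sq_integrable (D : set R) f : measurable_fun D f ->
  mu.-integrable D (EFin \o (fun x => f x ^+ 2)) -> sq_integrable D f.
Proof.
move=> mf /integrableP[_ fi]; split => //.
suff -> : (\int[mu]_(x in D) (f x ^+ 2)%:E =
  \int[mu]_(x in D) `|(EFin \o (fun x => f x ^+ 2)%R) x|)%E by [].
by apply: eq_integral => x _ /=; rewrite ger0_norm ?sqr_ge0.
Qed.

Lemma sq_integrableM (D : set R) f g : measurable D ->
  sq_integrable D f -> sq_integrable D g ->
  mu.-integrable D (EFin \o (fun x => f x * g x)).
Proof.
move=> mD f2 g2.
have [mf _] := f2; have [mg _] := g2.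
have i2 : mu.-integrable D (EFin \o (fun x => f x ^+ 2 + g x ^+ 2)).
  by apply: integrable_realD => //; exact: sq_integrable_sqr.
apply: (@le_integrable _ _ R mu D mD) i2.
  by apply/measurable_EFinP; exact: measurable_funM.
move=> x _ /=; rewrite lee_fin [leRHS]ger0_norm ?addr_ge0 ?sqr_ge0// ler_norml.
by apply/andP; split; [have := sqr_ge0 (f x + g x)|have := sqr_ge0 (f x - g x)]; nra.
Qed.

(** The multiplier only has to be bounded on [D], which is what cutoffs satisfy. *)
Lemma sq_integrable_bounded_mul (D : set R) f g (K : R) : measurable D ->
  measurable_fun D g -> (forall x, D x -> `|g x| <= K) ->
  sq_integrable D f -> sq_integrable D (fun x => g x * f x).
Proof.
move=> mD mg gK f2; have [mf _] := f2.
apply: integrable_sq_integrable; first exact: measurable_funM.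
have i2 : mu.-integrable D (EFin \o (fun x => K ^+ 2 * f x ^+ 2)).
  by apply: integrable_realZ => //; exact: sq_integrable_sqr.
apply: (@le_integrable _ _ R mu D mD) i2.
  by apply/measurable_EFinP; apply: measurable_funX; exact: measurable_funM.
move=> x Dx /=; rewrite lee_fin (ger0_norm (sqr_ge0 _)).
rewrite (ger0_norm (mulr_ge0 (sqr_ge0 _) (sqr_ge0 _))) exprMn.
rewrite ler_wpM2r ?sqr_ge0// -[leLHS]real_normK ?num_real//.
by rewrite ler_pXn2r ?nnegrE ?gK// (le_trans (normr_ge0 _) (gK _ Dx)).
Qed.

Section Edge.
Context (r : option R) (span0 : 0 < edge_span r).
Local Notation D := [set` edge_of r].

Lemma edge_dist_in x : 0 < edge_dist r x -> D x.
Proof.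
rewrite /edge_of /edge_dist; case: r => [l|]/=; rewrite in_itv/= ?andbT; last exact: ltW.
by rewrite lt_min subr_gt0.
Qed.

Lemma in_edge_dist x : D x -> x = 0 \/ 0 < edge_dist r x.
Proof.
rewrite /edge_of /edge_dist; case: r => [l|]/=; rewrite in_itv/= ?andbT.
  by rewrite lt_min subr_gt0 => ->; right.
by rewrite le_eqVlt => /predU1P[<-|]; [left|right].
Qed.

Lemma edge_dist_ge0 x : D x -> 0 <= edge_dist r x.
Proof.
rewrite /edge_of /edge_dist; case: r => [l|]/=; rewrite in_itv/= ?andbT//.
by rewrite le_min subr_ge0 => /andP[/ltW -> /ltW].
Qed.

Lemma edge_dist_gt0 x : 0 < x < edge_span r -> 0 < edge_dist r x.
Proof.
by rewrite /edge_span /edge_dist; case: r => [l|] /andP[//x0 xl]; rewrite lt_min x0 subr_gt0.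
Qed.

Lemma open_edge_dist : open [set x | 0 < edge_dist r x].
Proof.
rewrite /edge_dist; case: r => [l|]; last exact: open_gt.
have -> : [set x | 0 < Num.min x (l - x)] = `]0, l[%classic.
  by apply/seteqP; split => x /=; rewrite in_itv/= lt_min subr_gt0.
exact: interval_open.
Qed.

Lemma measurable_edge : measurable D. Proof. exact: measurable_itv. Qed.

Lemma measurable_fun_edge k :
  (forall x, 0 < edge_dist r x -> {for x, continuous k}) -> measurable_fun D k.
Proof.
move=> ck.
have : measurable_fun [set x | 0 < edge_dist r x] k.
  apply: open_continuous_measurable_fun; first exact: open_edge_dist.
  by move=> x; rewrite inE; exact: ck.
rewrite /edge_dist /edge_of; case: r => [l|].
  have -> : [set x | 0 < Num.min x (l - x)] = `]0, l[%classic; last by [].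
  by apply/seteqP; split => x /=; rewrite in_itv/= lt_min subr_gt0.
move=> mk; apply/measurable_fun_itv_obnd_cbndP.
have <- // : [set x | 0 < x] = `]0, +oo[%classic :> set R.
by apply/seteqP; split => x /=; rewrite in_itv/= andbT.
Qed.

(** The interior misses at most the point [0] of the edge. *)
Lemma ae_edge (P : R -> Prop) : (forall x, 0 < edge_dist r x -> P x) ->
  {ae mu, forall x, D x -> P x}.
Proof.
move=> HP; exists [set 0]; split; [exact: measurable_set1|exact: lebesgue_measure_set1|].
move=> x /= nP; apply: contrapT => x0; apply: nP => /in_edge_dist[//|]; exact: HP.
Qed.

(** The value at [0] on a lead is unconstrained, hence the term [`|k 0|] in the
    dominating constant. *)
Lemma bounded_span_integrable k (M : R) : 0 <= M -> measurable_fun D k ->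
  (forall x, 0 < edge_dist r x -> `|k x| <= if x <= edge_span r then M else 0) ->
  mu.-integrable D (EFin \o k).
Proof.
move=> M0 mk kM.
pose C := M + `|k 0|.
have iC : mu.-integrable `[0, edge_span r] (EFin \o cst C).
  apply: continuous_compact_integrable; first exact: segment_compact.
  by apply: continuous_subspaceT => x; exact: cvg_cst.
have {}iC : mu.-integrable setT ((EFin \o cst C) \_ `[0, edge_span r]).
  by apply: (@integrable_mkcond _ _ R mu _ (EFin \o cst C) _).1 iC; exact: measurable_itv.
have {}iC : mu.-integrable D ((EFin \o cst C) \_ `[0, edge_span r]).
  by apply: integrableS iC => //; exact: measurable_edge.
apply: (@le_integrable _ _ R mu D measurable_edge) iC.
  by apply/measurable_EFinP.
move=> x Dx /=; rewrite patchE.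
have C0 : 0 <= C by rewrite addr_ge0.
have [->|x0] := in_edge_dist Dx.
  rewrite mem_set; last by rewrite /= in_itv/= lexx ltW.
  by rewrite /= lee_fin (ger0_norm C0) lerDr.
have := kM x x0; case: ifPn => xl.
  rewrite mem_set; last first.
    move: x0; rewrite /= in_itv/= xl andbT /edge_dist; case: r => [l|]; last exact: ltW.
    by rewrite lt_min => /andP[/ltW].
  by rewrite /= lee_fin (ger0_norm C0) => /le_trans; apply; rewrite lerDl.
by rewrite normr_le0 => /eqP ->; rewrite normr0 abse_ge0.
Qed.

(** Beyond the span of an edge lies, on a lead only, a region where the
    integrand vanishes. *)
Lemma integral_edge_span k : mu.-integrable D (EFin \o k) ->
  (forall x, 0 < edge_dist r x -> edge_span r <= x -> k x = 0) ->
  \int[mu]_(x in D) k x = \int[mu]_(x in `]0, edge_span r[) k x.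
Proof.
rewrite /edge_of /edge_span /edge_dist; case: r => [l|]// ik k0.
have i1 : mu.-integrable `]0, +oo[ (EFin \o k).
  by apply: integrableS ik => //; apply: subset_itvr; rewrite bnd_simp.
rewrite -Rintegral_itv_obnd_cbnd// -[LHS](subrK (\int[mu]_(x in `]0, 1]) k x)).
rewrite Rintegral_itvB//; last by rewrite bnd_simp.
rewrite (_ : \int[mu]_(x in `]1, +oo[) k x = 0) ?add0r; last first.
  rewrite /Rintegral integral0_eq// => x /=; rewrite in_itv/= andbT => x1.
  by rewrite k0// ?ltW// (lt_trans ltr01).
rewrite Rintegral_itv_bndo_bndc//.
by apply: integrableS i1 => //; apply: subset_itvl; rewrite bnd_simp.
Qed.

End Edge.

End EdgeIntegrals.

(** * Energy of a truncated function *)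

Section CutoffEnergy.
Context (R : realType).
Local Notation mu := (@lebesgue_measure R).
Context (r : option R) (span0 : 0 < edge_span r).
Local Notation D := [set` edge_of r].
Local Notation dist := (edge_dist r).

(** A function vanishing at the ends with a derivative that stays bounded there,
    in the quantitative form that survives multiplication by [cut1] and
    [cut2]. *)
Definition dirichlet_C1 (del C : R) (h h1 : R -> R) :=
  [/\ forall x, 0 < dist x -> is_derive x 1 h (h1 x),
      forall x, 0 < dist x -> {for x, continuous h1} &
      forall x, 0 < dist x -> dist x < del ->
        `|h x| <= C * dist x /\ `|h1 x| <= C].

Context (del C : R) (C0 : 0 <= C) (h h1 w : R -> R).
Hypotheses (hC1 : dirichlet_C1 del C h h1).
Hypotheses (h2 : sq_integrable D h) (w2 : sq_integrable D w).

Let mD : measurable D := measurable_edge r.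

Lemma dirichlet_continuous x : 0 < dist x -> {for x, continuous h}.
Proof.
move=> x0; apply/differentiable_continuous/derivable1_diffP.
by have [dh _ _] := hC1; have [] := dh x x0.
Qed.

(** What the differential expression becomes on [cut * h] when [w] is its value
    on [h]; no second derivative of [h] appears, so it makes sense for an
    arbitrary [w]. *)
Definition cut_expr nu x :=
  cut r nu x * w x - 2 * cut1 r nu x * h1 x - cut2 r nu x * h x.

Lemma continuous_cut nu : continuous (cut r nu).
Proof.
move=> x; apply/differentiable_continuous/derivable1_diffP.
by have [] := is_derive_cut r nu x.
Qed.

Lemma continuous_cut1 nu : continuous (cut1 r nu).
Proof.
move=> x; apply/differentiable_continuous/derivable1_diffP.
by have [] := is_derive_cut1 r nu x.
Qed.

Lemma measurable_cut nu :
  [/\ measurable_fun D (cut r nu), measurable_fun D (cut1 r nu) &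
      measurable_fun D (cut2 r nu)].
Proof.
split; apply: measurable_fun_edge => x _.
- exact: continuous_cut.
- exact: continuous_cut1.
- exact: continuous_cut2.
Qed.

Lemma measurable_dirichlet : measurable_fun D h1.
Proof. by apply: measurable_fun_edge; have [] := hC1. Qed.

Section FixedCutoff.
Context (nu : R).
Hypotheses (nu1 : 1 <= nu) (nu_span : 2 <= nu * edge_span r)
  (nu_del : 1 <= nu * del).

Let nu0 : 0 < nu := lt_le_trans ltr01 nu1.

Lemma cut_sq_integrable : sq_integrable D (fun x => cut r nu x * h x).
Proof.
have [m0 _ _] := measurable_cut nu.
apply: (@sq_integrable_bounded_mul _ _ _ _ 1) => // x Dx.
by have [] := cut_bounds nu1 nu_span (edge_dist_ge0 Dx).
Qed.

(** Either the cutoff is locally trivial, or the point is close enough to an end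
    for the bounds on [h] and [h1] to hold. *)
Lemma cut_cases x : 0 < dist x ->
  [/\ cut r nu x = 1, cut1 r nu x = 0 & cut2 r nu x = 0] \/
  [/\ nu * dist x < 1, `|h x| <= C * dist x, `|h1 x| <= C, x <= edge_span r &
      dist x = Num.min x (edge_span r - x)].
Proof.
move=> x0; have [far|near_x] := leP 1 (nu * dist x); first by left; exact: cut_far.
right; have [_ _ hb] := hC1.
have [] := hb x x0; first by rewrite -(ltr_pM2l nu0) (lt_le_trans near_x).
have dE := edge_dist_near nu_span near_x x0.
split=> //; move: x0; rewrite dE lt_min subr_gt0 => /andP[_ /ltW]//.
Qed.

(** The term with [h1] is the delicate one: [h1] is not known to be square
    integrable, but [cut1] lives where [h1] is bounded. *)
Lemma cut_expr_sq_integrable : sq_integrable D (cut_expr nu).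
Proof.
have [m0 m1 m2] := measurable_cut nu.
have [mh _] := h2; have mh1 := measurable_dirichlet.
apply: sq_integrableD; first apply: sq_integrableD.
- apply: (@sq_integrable_bounded_mul _ _ _ _ 1) => // x Dx.
  by have [] := cut_bounds nu1 nu_span (edge_dist_ge0 Dx).
- have m : measurable_fun D (fun x => - (2 * cut1 r nu x * h1 x)).
    apply: measurableT_comp => //; apply: measurable_funM => //.
    by apply: measurable_funM => //; exact: measurable_cst.
  apply: integrable_sq_integrable => //.
  apply: (@bounded_span_integrable _ _ _ _ ((2 * (3 * nu) * C) ^+ 2)) => //.
  + exact: sqr_ge0.
  + exact: measurable_funX.
  + move=> x x0; have [_ _ b1 _] := cut_bounds nu1 nu_span (ltW x0).
    have [[_ -> _]|[_ _ hb -> _]] := cut_cases x0.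
      by rewrite mulr0 mul0r oppr0 expr0n/= normr0; case: ifP => // _; exact: sqr_ge0.
    rewrite normrX ler_pXn2r ?nnegrE// ?mulr_ge0 ?(ltW nu0)//.
    by rewrite normrN !normrM ger0_norm// !ler_pM// mulr_ge0.
- have m : measurable_fun D (fun x => - cut2 r nu x).
    by apply: measurableT_comp.
  rewrite (_ : (fun x => _) = (fun x => (- cut2 r nu x) * h x)); last first.
    by apply/funext => x; rewrite mulNr.
  apply: (@sq_integrable_bounded_mul _ _ _ _ (6 * nu ^+ 2)) => // x Dx.
  by rewrite normrN; have [] := cut_bounds nu1 nu_span (edge_dist_ge0 Dx).
Qed.

Let G x := cut r nu x * cut1 r nu x * (h x * h x).
Let g x := (cut1 r nu x ^+ 2 + cut r nu x * cut2 r nu x) * (h x * h x) +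
  2 * (cut r nu x * cut1 r nu x * (h x * h1 x)).

(** [G] is the boundary term of the integration by parts in [cut_energy]. *)
Lemma flux_derive x : 0 < dist x -> is_derive x 1 G (g x).
Proof.
move=> x0; have [dh _ _] := hC1; have dhx := dh x x0.
have d0 := is_derive_cut r nu x; have d1 := is_derive_cut1 r nu x.
have H := is_deriveM (is_deriveM d0 d1) (is_deriveM dhx dhx).
apply: is_derive_eq; rewrite /GRing.scale/= /g.
rewrite -[(cut r nu * cut1 r nu) x]/(cut r nu x * cut1 r nu x).
rewrite -[(h * h) x]/(h x * h x).
ring.
Qed.

Lemma flux_continuous x : 0 < dist x -> {for x, continuous g}.
Proof.
move=> x0; have [_ ch1 _] := hC1.
have ch := dirichlet_continuous x0.
have c0 := @continuous_cut nu x; have c1 := @continuous_cut1 nu x.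
have c2 := @continuous_cut2 _ r nu x.
apply: cvgD.
  apply: cvgM; last exact: cvgM.
  by apply: cvgD; [rewrite expr2; apply: cvgM|apply: cvgM].
apply: cvgM; first exact: cvg_cst.
by apply: cvgM; apply: cvgM => //; exact: ch1.
Qed.

(* A crude constant: [36 nu^2] dominates [cut1^2 + |cut * cut2|], and the second
   summand covers the terms of first order in [nu]. *)
Let M : R := (36 * nu ^+ 2 * C ^+ 2) + 36 * nu * C ^+ 2.

(** Both [G] and its derivative vanish to first order at the ends and are
    identically zero away from them. *)
Lemma flux_bounds x : 0 < dist x ->
  (x <= edge_span r /\ dist x = Num.min x (edge_span r - x) /\
    `|G x| <= M * dist x /\ `|g x| <= M * dist x) \/
  (G x = 0 /\ g x = 0).
Proof.
move=> x0; have [b0 b0' b1 b2] := cut_bounds nu1 nu_span (ltW x0).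
have [[e0 e1 e2]|[near_x hb h1b xs dE]] := cut_cases x0.
  by right; rewrite /G /g e0 e1 e2 expr0n/=; split; ring.
left; do 2!split => //.
have d1 : dist x <= 1.
  rewrite (le_trans _ (ltW near_x))// -[leLHS]mul1r ler_wpM2r// ltW//.
have hh : `|h x * h x| <= C ^+ 2 * dist x.
  rewrite normrM (le_trans (ler_pM _ _ hb hb))//.
  rewrite (_ : C * dist x * (C * dist x) = C ^+ 2 * dist x * dist x); last by ring.
  by rewrite ler_piMr// mulr_ge0 ?sqr_ge0// ltW.
have C20 : 0 <= C ^+ 2 * dist x by rewrite mulr_ge0 ?sqr_ge0// ltW.
have nu20 : 0 <= nu ^+ 2 by exact: sqr_ge0.
have p0 : 0 <= nu * (C ^+ 2 * dist x) by rewrite mulr_ge0// ltW.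
have q0 : 0 <= nu ^+ 2 * (C ^+ 2 * dist x) by rewrite mulr_ge0.
have ME : M * dist x =
    36 * (nu ^+ 2 * (C ^+ 2 * dist x)) + 36 * (nu * (C ^+ 2 * dist x)).
  by rewrite /M; ring.
have l1 : `|cut r nu x * cut1 r nu x| <= 3 * nu.
  by rewrite normrM -[leRHS]mul1r ler_pM.
have l2 : `|cut1 r nu x ^+ 2 + cut r nu x * cut2 r nu x| <= 36 * nu ^+ 2.
  have : `|cut1 r nu x| ^+ 2 <= (3 * nu) ^+ 2.
    by rewrite ler_pXn2r ?nnegrE// mulr_ge0// ltW.
  have : `|cut r nu x| * `|cut2 r nu x| <= 1 * (6 * nu ^+ 2) by rewrite ler_pM.
  rewrite -normrX -normrM exprMn.
  have := ler_normD (cut1 r nu x ^+ 2) (cut r nu x * cut2 r nu x); lra.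
have h1h : `|h x * h1 x| <= C ^+ 2 * dist x.
  rewrite normrM (le_trans (ler_pM _ _ hb h1b))//.
  by rewrite le_eqVlt; apply/orP; left; apply/eqP; ring.
have k1 := ler_pM (normr_ge0 _) (normr_ge0 _) l1 hh.
have k2 := ler_pM (normr_ge0 _) (normr_ge0 _) l2 hh.
have k3 := ler_pM (normr_ge0 _) (normr_ge0 _) l1 h1h.
rewrite -!normrM -!mulrA in k1 k2 k3.
split; rewrite ME /G /g -?mulrA; first lra.
rewrite (le_trans (ler_normD _ _))// (normrM 2) (ger0_norm (ler0n _ 2)) lerD//.
lra.
Qed.

(** The two integrands differ by the derivative of [cut * cut1 * h^2], which has
    zero integral. *)
Lemma cut_energy :
  \int[mu]_(x in D) (cut_expr nu x * (cut r nu x * h x)) =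
  \int[mu]_(x in D) (cut r nu x ^+ 2 * (w x * h x) + cut1 r nu x ^+ 2 * h x ^+ 2).
Proof.
have [m0 m1 m2] := measurable_cut nu.
have [mh _] := h2; have mh1 := measurable_dirichlet.
have M0 : 0 <= M by rewrite addr_ge0// !mulr_ge0 ?sqr_ge0// ltW.
have mg : measurable_fun D g by apply: measurable_fun_edge; exact: flux_continuous.
have ig : mu.-integrable D (EFin \o g).
  apply: (@bounded_span_integrable _ _ _ _ (M * edge_span r)) => //.
    by rewrite mulr_ge0// ltW.
  move=> x x0; have [[xs [dE [_ gM]]]|[_ ->]] := flux_bounds x0.
    rewrite xs (le_trans gM)// ler_wpM2l// dE ge_min xs//.
  by rewrite normr0; case: ifP => // _; rewrite mulr_ge0// ltW.
have span_dist x : 0 < x < edge_span r ->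
    0 < Num.min x (edge_span r - x).
  by rewrite lt_min subr_gt0.
have g0 : \int[mu]_(x in D) g x = 0.
  rewrite integral_edge_span//; last first.
    move=> x x0 sx; have [[xs [dE _]]|[]//] := flux_bounds x0.
    by move: x0; rewrite dE lt_min subr_gt0 => /andP[_]; rewrite ltNge sx.
  apply: (@integral_derivative_vanishing _ _ M G) => //.
  - by move=> x xs; apply: flux_derive; exact: edge_dist_gt0.
  - by move=> x xs; apply: flux_continuous; exact: edge_dist_gt0.
  - move=> x xs; have x0 := edge_dist_gt0 xs.
    have [[_ [<- []]//]|[-> _]] := flux_bounds x0.
    by rewrite normr0 mulr_ge0// ltW// span_dist.
  - move=> x xs; have x0 := edge_dist_gt0 xs.
    have [[_ [<- []]//]|[_ ->]] := flux_bounds x0.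
    by rewrite normr0 mulr_ge0// ltW// span_dist.
have il : mu.-integrable D (EFin \o (fun x => cut_expr nu x * (cut r nu x * h x))).
  by apply: sq_integrableM => //; [exact: cut_expr_sq_integrable|exact: cut_sq_integrable].
rewrite -[LHS]addr0 -g0 -(@RintegralD _ _ _ mu D)//.
by apply: eq_Rintegral => x _; rewrite /cut_expr /g; ring.
Qed.

End FixedCutoff.

End CutoffEnergy.

Section CutoffLimit.
Context (R : realType).
Local Notation mu := (@lebesgue_measure R).
Context (r : option R) (span0 : 0 < edge_span r).
Local Notation D := [set` edge_of r].
Local Notation dist := (edge_dist r).

Context (del C : R) (del0 : 0 < del) (C0 : 0 <= C) (h h1 w : R -> R).
Hypotheses (hC1 : dirichlet_C1 r del C h h1).
Hypotheses (h2 : sq_integrable D h) (w2 : sq_integrable D w).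

Let mD : measurable D := measurable_edge r.

Lemma cutoff_large : \forall n \near \oo,
  [/\ 1 <= n%:R :> R, 2 <= n%:R * edge_span r & 1 <= n%:R * del].
Proof.
near=> n.
have : Num.max 1 (Num.max (2 / edge_span r) del^-1) <= n%:R.
  by near: n; exact: nbhs_infty_ger.
by rewrite !ge_max ler_pdivrMr// -[del^-1]mul1r ler_pdivrMr// => /andP[-> /andP[-> ->]].
Unshelve. all: by end_near. Qed.

(** Dominated convergence after [cut_energy]: for each interior point the cutoff
    is trivial for large [n], and [cut1 * h] is bounded uniformly in [n] because
    [cut1 = O(n)] is supported where [h = O(1/n)]. *)
Lemma cut_energy_cvg :
  (\int[mu]_(x in D) (cut_expr r h h1 w n%:R x * (cut r n%:R x * h x))) @[n --> \oo] -->
  \int[mu]_(x in D) (w x * h x).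
Proof.
have iwh : mu.-integrable D (EFin \o (fun x => w x * h x)) by exact: sq_integrableM.
have [mh _] := h2; have [mw _] := w2.
have [n0 _ n0P] := cutoff_large.
rewrite -(cvg_shiftn n0).
pose F n x := cut r (n + n0)%:R x ^+ 2 * (w x * h x) + cut1 r (n + n0)%:R x ^+ 2 * h x ^+ 2.
rewrite (_ : (fun n => _) = (fun n => \int[mu]_(x in D) F n x)); last first.
  apply/funext => n /=; have [n1 ns nd] := n0P _ (leq_addl n n0).
  exact: (cut_energy span0 C0 hC1).
(* [9 C^2] bounds [(cut1 * h)^2]: [cut1] is at most [3 n], and [h] at most [C / n]
   on its support. *)
pose dom x := `|w x * h x| + (if x <= edge_span r then 9 * C ^+ 2 else 0).
have mF n : measurable_fun D (F n).
  have [m0 m1 _] := measurable_cut r (n + n0)%:R.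
  apply: measurable_funD; apply: measurable_funM; try exact: measurable_funX.
  exact: measurable_funM.
have idom : mu.-integrable D (EFin \o dom).
  apply: integrable_realD => //; first exact: (@integrable_norm _ _ _ mu).
  apply: (@bounded_span_integrable _ _ _ _ (9 * C ^+ 2)) => //.
  - by rewrite mulr_ge0 ?sqr_ge0.
  - apply: measurable_funTS; apply: measurable_fun_ifT => //.
    by apply: measurable_fun_ler.
  - by move=> x _; case: ifP => _; rewrite ?normr0// ger0_norm// mulr_ge0 ?sqr_ge0.
have [|||||iF _ cvF] := @dominated_convergence _ _ R mu D mD
  (fun n => EFin \o F n) (EFin \o (fun x => w x * h x)) (EFin \o dom).
- by move=> n; apply/measurable_EFinP; exact: mF.
- by apply/measurable_EFinP; exact: measurable_funM.
- apply: ae_edge => x x0; apply: cvg_near_cst.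
  near=> n.
  have [n1 ns _] := n0P _ (leq_addl n n0).
  rewrite /F /=; have [] := @cut_far _ r (n + n0)%:R x n1 ns.
    rewrite -ler_pdivrMr// natrD ler_wpDr//.
    by near: n; exact: nbhs_infty_ger.
  by move=> -> -> _; rewrite expr1n expr0n/= mul0r mul1r addr0.
- exact: idom.
- suff H : {ae mu, forall x, D x -> forall n, (`|(EFin \o F n) x| <= (EFin \o dom) x)%E}.
    by apply: ae_imp H => x H n Dx; exact: H.
  apply: ae_edge => x x0 n.
  have [n1 ns nd] := n0P _ (leq_addl n n0).
  have [b0 _ b1 _] := cut_bounds n1 ns (ltW x0).
  rewrite /= lee_fin /F /dom (le_trans (ler_normD _ _))// lerD//.
    rewrite normrM normrX ler_piMl// exprn_ile1//.
  have [[_ -> _]|[near_x hb _ xs _]] := cut_cases hC1 n1 ns nd x0.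
    by rewrite expr0n/= mul0r normr0; case: ifP => // _; rewrite mulr_ge0 ?sqr_ge0.
  rewrite xs -exprMn normrX normrM.
  have : `|cut1 r (n + n0)%:R x| * `|h x| <= 3 * C.
    rewrite (le_trans (ler_pM _ _ b1 hb))//.
    rewrite (_ : 3 * (n + n0)%:R * (C * edge_dist r x) =
      3 * C * ((n + n0)%:R * edge_dist r x)); last by ring.
    by rewrite ler_piMr ?mulr_ge0// ltW.
  move=> H; rewrite (_ : 9 * C ^+ 2 = (3 * C) ^+ 2); last by rewrite exprMn -natrX.
  by rewrite ler_pXn2r ?nnegrE// mulr_ge0.
apply: fine_cvg; move: cvF; rewrite fineK//.
exact: (@integrable_fin_num _ _ _ mu).
Unshelve. all: by end_near. Qed.

End CutoffLimit.

(** * Truncated functions near the ends *)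

Section EndpointLimits.
Context (R : realType).
Local Notation mu := (@lebesgue_measure R).
Context (r : option R) (span0 : 0 < edge_span r).
Local Notation D := [set` edge_of r].
Local Notation dist := (edge_dist r).
Implicit Types (h k : R -> R).

(** Only [0] is an end of a lead, so [l1] is meaningless there. *)
Definition ends_cvg h (l0 l1 : R) :=
  h x @[x --> 0^'+] --> l0 /\
  (if r is Some l then h x @[x --> l^'-] --> l1 else True).

Lemma edge_dist_lipschitz x y : dist x - `|x - y| <= dist y.
Proof.
have h1 := ler_norm (x - y); have := ler_norm (- (x - y)); rewrite normrN => h2.
rewrite /edge_dist; case: r => [l|]; last lra.
rewrite le_min; apply/andP; split.
- have : Num.min x (l - x) <= x by rewrite ge_min lexx.
  lra.
- have : Num.min x (l - x) <= l - x by rewrite ge_min lexx orbT.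
  lra.
Qed.

Lemma AC_loc_at h x : AC_loc D h -> 0 < dist x ->
  abs_continuous (x - dist x / 2) (x + dist x / 2) h.
Proof.
move=> ac x0; apply: ac; first lra.
move=> y /=; rewrite in_itv/= => /andP[y1 y2]; apply: edge_dist_in.
have := edge_dist_lipschitz x y.
have : `|x - y| <= dist x / 2 by rewrite ler_norml; apply/andP; split; lra.
lra.
Qed.

Lemma AC_loc_continuous h x : AC_loc D h -> 0 < dist x -> {for x, continuous h}.
Proof.
by move=> ac x0; apply: (abs_continuous_at _ (AC_loc_at ac x0)); rewrite divr_gt0.
Qed.

Lemma AC_loc_is_derive h h1 x : AC_loc D h -> AC_loc D h1 ->
  {ae mu, forall y, D y -> is_derive y 1 h (h1 y)} ->
  0 < dist x -> is_derive x 1 h (h1 x).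
Proof.
move=> ach ach1 aeh x0; apply: (ac_is_derive _ (AC_loc_at ach x0)).
- by rewrite divr_gt0.
- exact: AC_loc_continuous.
- apply: ae_imp aeh => y H; rewrite /= in_itv/= => /andP[y1 y2]; apply: H.
  apply: edge_dist_in; have := edge_dist_lipschitz x y.
  have : `|x - y| <= dist x / 2 by rewrite ler_norml; apply/andP; split; lra.
  lra.
Qed.

(** Lets one endpoint of an increment tend to a zero of [h]. *)
Lemma increment_limit (F : set_system R) {FF : ProperFilter F} h (p x C : R) :
  y @[y --> F] --> p -> h y @[y --> F] --> 0 ->
  (\forall y \near F, `|h x - h y| <= C * `|x - y|) -> `|h x| <= C * `|x - p|.
Proof.
move=> Fp Fh H.
have l1 : `|h x - h y| @[y --> F] --> `|h x - 0|.
  by apply: cvg_norm; apply: cvgB; [exact: cvg_cst|].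
have l2 : C * `|x - y| @[y --> F] --> C * `|x - p|.
  apply: cvgM; first exact: cvg_cst.
  by apply: cvg_norm; apply: cvgB; [exact: cvg_cst|].
rewrite -[h x]subr0; exact: ler_cvg_to l1 l2 H.
Qed.

Lemma cvg_bounded_near (F : set_system R) {FF : ProperFilter F} h (d : R) :
  h y @[y --> F] --> d -> \forall y \near F, `|h y| <= `|d| + 1.
Proof.
move=> /cvgrPdist_le/(_ 1 ltr01); apply: filterS => y H.
by rewrite -lerBlDl (le_trans _ H)// distrC lerB_dist.
Qed.

Lemma derive_increment h h1 (C a b : R) : a <= b ->
  (forall x, a <= x <= b -> is_derive x 1 h (h1 x)) ->
  (forall x, a <= x <= b -> `|h1 x| <= C) -> `|h b - h a| <= C * (b - a).
Proof.
move=> ab dh hC.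
have [||c /[!in_itv]/= cab ->] := @MVT_segment R h h1 a b ab.
- by move=> x /[!in_itv]/= /andP[/ltW ax /ltW xb]; apply: dh; rewrite ax.
- apply: derivable_within_continuous => x /[!in_itv]/= xab.
  by have [] := dh x xab.
rewrite normrM (ger0_norm (_ : 0 <= b - a)) ?subr_ge0//.
by apply: ler_wpM2r; [rewrite subr_ge0|exact: hC].
Qed.

(** A derivative bounded near an end forces a vanishing function to be
    controlled by the distance to that end. *)
Lemma dirichlet_C1_of_limits h h1 d0 d1 : AC_loc D h -> AC_loc D h1 ->
  {ae mu, forall y, D y -> is_derive y 1 h (h1 y)} ->
  ends_cvg h 0 0 -> ends_cvg h1 d0 d1 ->
  exists del C, [/\ 0 < del, 0 <= C & dirichlet_C1 r del C h h1].
Proof.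
move=> ach ach1 aeh [h0 hl] [h10 h1l].
have dh x : 0 < dist x -> is_derive x 1 h (h1 x) by exact: AC_loc_is_derive.
have ch1 x : 0 < dist x -> {for x, continuous h1} by exact: AC_loc_continuous.
have end0 : exists2 e, 0 < e & forall x, 0 < dist x -> 0 < x -> x < e ->
    (forall z, 0 < z -> z <= x -> 0 < dist z) ->
    `|h x| <= (`|d0| + 1) * x /\ `|h1 x| <= `|d0| + 1.
  have : \forall y \near 0^'+, `|h1 y| <= `|d0| + 1 by exact: cvg_bounded_near.
  rewrite near_withinE => /nbhs_ballP[e /= e0 eP].
  have h1C z : 0 < z -> z < e -> `|h1 z| <= `|d0| + 1.
    by move=> z0 ze; apply: eP => //; rewrite /ball/= sub0r normrN gtr0_norm.
  exists e => // x _ x0 xe inx; split; last exact: h1C.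
  suff : `|h x| <= (`|d0| + 1) * `|x - 0| by rewrite subr0 (gtr0_norm x0).
  apply: (@increment_limit 0^'+ _ h 0 x) => //; first exact: cvg_at_right_filter.
  near=> y; have y0 : 0 < y by near: y; exact: nbhs_right_gt.
  have yx : y <= x by near: y; exact: nbhs_right_le.
  rewrite (ger0_norm (_ : 0 <= x - y)) ?subr_ge0//.
  apply: derive_increment => // z /andP[yz zx].
    by apply: dh; apply: inx => //; exact: lt_le_trans yz.
  by apply: h1C; [exact: lt_le_trans yz|exact: le_lt_trans xe].
move: hl h1l end0; rewrite /dirichlet_C1 /edge_dist.
move: (span0) dh ch1; rewrite /edge_span /edge_dist.
case: r => [l|] span_l dh ch1 hl h1l [e0 e00 H0]; last first.
  exists e0, (`|d0| + 1); split=> //; split=> // x x0 xe.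
  exact: H0.
have : \forall y \near l^'-, `|h1 y| <= `|d1| + 1 by exact: cvg_bounded_near.
rewrite near_withinE => /nbhs_ballP[e1 /= e10 eP].
have h1C z : z < l -> l - z < e1 -> `|h1 z| <= `|d1| + 1.
  by move=> zl ze; apply: eP => //; rewrite /ball/= gtr0_norm// subr_gt0.
exists (Num.min e0 e1), (`|d0| + `|d1| + 1); split.
- by rewrite lt_min e00.
- by rewrite !addr_ge0.
split=> // x xdist; have := xdist; rewrite lt_min subr_gt0 => /andP[x0 xl].
have C01 : `|d0| + 1 <= `|d0| + `|d1| + 1 by have := normr_ge0 d1; lra.
have C11 : `|d1| + 1 <= `|d0| + `|d1| + 1 by have := normr_ge0 d0; lra.
have [xlx|lxx] := leP x (l - x); rewrite lt_min => /andP[xe0 xe1].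
  have [||||hx h1x] := H0 x => //.
    move=> z z0 zx; rewrite lt_min z0 subr_gt0; exact: le_lt_trans xl.
  by split; rewrite ?(le_trans h1x)// (le_trans hx)// ler_wpM2r// ltW.
split; last by rewrite (le_trans (h1C _ xl xe1)).
apply: (@le_trans _ _ ((`|d1| + 1) * (l - x))); last by rewrite ler_wpM2r// subr_ge0 ltW.
rewrite (_ : l - x = `|x - l|); last by rewrite distrC gtr0_norm// subr_gt0.
apply: (@increment_limit l^'- _ h l x) => //; first exact: cvg_at_left_filter.
near=> y; have yl : y < l by near: y; exact: nbhs_left_lt.
have xy : x <= y by near: y; exact: nbhs_left_ge.
rewrite distrC (distrC x) (ger0_norm (_ : 0 <= y - x)) ?subr_ge0//.
apply: derive_increment => // z /andP[xz zy].
  by apply: dh; rewrite lt_min subr_gt0 (lt_le_trans x0)//= (le_lt_trans zy).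
apply: h1C; first exact: le_lt_trans yl.
by rewrite (le_lt_trans _ xe1)// lerD2l lerN2.
Unshelve. all: by end_near. Qed.

Section CutoffAtEnds.
Context (nu : R).
Hypotheses (nu1 : 1 <= nu) (nu_span : 2 <= nu * edge_span r).

(** A linear bound near the ends is all that is needed, as [edge_dist] itself
    tends to [0] there. *)
Lemma ends_cvg_dominated (K : R) k : 0 <= K ->
  (forall x, 0 < dist x -> nu * dist x < 1 -> `|k x| <= K * dist x) ->
  ends_cvg k 0 0.
Proof.
move=> K0 kK; have nu0 : 0 < nu := lt_le_trans ltr01 nu1.
have K1 : 0 < K + 1 by rewrite ltr_wpDl.
split.
- apply/cvgrPdist_le => e e0; near=> x; rewrite sub0r normrN.
  have x0 : 0 < x by near: x; exact: nbhs_right_gt.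
  have xs : x < edge_span r by near: x; exact: nbhs_right_lt.
  have xe : x < e / (K + 1) by near: x; apply: nbhs_right_lt; rewrite divr_gt0.
  have xn : x < nu^-1 by near: x; apply: nbhs_right_lt; rewrite invr_gt0.
  have dx : dist x <= x.
    by rewrite /edge_dist; case: r => // l; rewrite ge_min lexx.
  have d0 : 0 < dist x by apply: edge_dist_gt0; rewrite x0.
  rewrite (le_trans (kK x d0 _))//.
    rewrite (le_lt_trans (ler_wpM2l (ltW nu0) dx))//.
    by rewrite -(@divff _ nu) ?gt_eqF// ltr_pM2l.
  rewrite (le_trans (ler_wpM2l K0 dx))//; move: xe; rewrite ltr_pdivlMr//; nra.
- move: (span0) kK; rewrite /edge_span /edge_dist; case: r => // l l0 kK.
  apply/cvgrPdist_le => e e0; near=> x; rewrite sub0r normrN.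
  have x0 : 0 < x by near: x; exact: nbhs_left_gt.
  have xl : x < l by near: x; exact: nbhs_left_lt.
  have xe : l - x < e / (K + 1) by near: x; apply: nbhs_left_ltBl; rewrite divr_gt0.
  have xn : l - x < nu^-1 by near: x; apply: nbhs_left_ltBl; rewrite invr_gt0.
  have dx : Num.min x (l - x) <= l - x by rewrite ge_min lexx orbT.
  rewrite (le_trans (kK x _ _))//.
  + by rewrite lt_min x0 subr_gt0.
  + rewrite (le_lt_trans (ler_wpM2l (ltW nu0) dx))//.
    by rewrite -(@divff _ nu) ?gt_eqF// ltr_pM2l.
  rewrite (le_trans (ler_wpM2l K0 dx))//; move: xe; rewrite ltr_pdivlMr//; nra.
Unshelve. all: by end_near. Qed.

Context (del C : R) (C0 : 0 <= C) (h h1 : R -> R).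
Hypotheses (nu_del : 1 <= nu * del) (hC1 : dirichlet_C1 r del C h h1).

Lemma cut_ends_cvg : ends_cvg (fun x => cut r nu x * h x) 0 0.
Proof.
apply: (ends_cvg_dominated C0) => x x0 near_x.
have [b0 _ _ _] := cut_bounds nu1 nu_span (ltW x0).
have [[e0 _ _]|[_ hb _ _ _]] := cut_cases hC1 nu1 nu_span nu_del x0.
  have [_ _ hb] := hC1.
  rewrite e0 mul1r; have [] // := hb x x0.
  by rewrite -(ltr_pM2l (lt_le_trans ltr01 nu1)) (lt_le_trans near_x).
by rewrite normrM -[leRHS]mul1r ler_pM.
Qed.

(** [cut1 * h] tends to [0] because [h] does, [cut * h1] because [cut] does. *)
Lemma cut_derive_ends_cvg :
  ends_cvg (fun x => cut1 r nu x * h x + cut r nu x * h1 x) 0 0.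
Proof.
have nu0 : 0 <= nu := le_trans ler01 nu1.
apply: (@ends_cvg_dominated (6 * nu * C)); first by rewrite !mulr_ge0.
move=> x x0 near_x; have [_ _ hb] := hC1.
have [|hx h1x] := hb x x0.
  by rewrite -(ltr_pM2l (lt_le_trans ltr01 nu1)) (lt_le_trans near_x).
have [_ b0 b1 _] := cut_bounds nu1 nu_span (ltW x0).
rewrite (le_trans (ler_normD _ _))// !normrM.
have := ler_pM (normr_ge0 _) (normr_ge0 _) b1 hx.
have := ler_pM (normr_ge0 _) (normr_ge0 _) b0 h1x.
lra.
Qed.

End CutoffAtEnds.

Lemma abs_continuous_of_C1 (a b : R) k k1 :
  (forall x : R, is_derive x 1 k (k1 x)) ->
  continuous k1 -> abs_continuous a b k.
Proof.
move=> dk ck1; have [ab|ba] := leP a b; last first.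
  apply: (abs_continuous_lipschitz (lexx 0)) => s t sa st tb.
  by have := lt_le_trans ba (le_trans sa (le_trans st tb)); rewrite ltxx.
have ck : {within `[a, b], continuous k1} by exact: continuous_subspaceT.
have [c1 _ H1] := EVT_max ab ck; have [c2 _ H2] := EVT_min ab ck.
have K0 : 0 <= `|k1 c1| + `|k1 c2| by rewrite addr_ge0.
apply: (abs_continuous_lipschitz K0) => s t sa st tb.
apply: (@derive_increment k k1 _ _ _ st (fun x _ => dk x)) => x /andP[sx xt].
have xab : x \in `[a, b] by rewrite in_itv/= (le_trans sa)//= (le_trans xt).
have := H1 x xab; have := H2 x xab; rewrite ler_norml => l u; apply/andP; split.
- have := ler_norm (- k1 c2); rewrite normrN; have := normr_ge0 (k1 c1); lra.
- have := ler_norm (k1 c1); have := normr_ge0 (k1 c2); lra.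
Qed.

Lemma AC_loc_cut nu h : AC_loc D h -> AC_loc D (fun x => cut r nu x * h x).
Proof.
move=> ach a b ab sub; apply: abs_continuousM => //; last exact: ach.
by apply: abs_continuous_of_C1 (@continuous_cut1 _ r nu) => x; exact: is_derive_cut.
Qed.

Lemma AC_loc_cut1 nu h : AC_loc D h -> AC_loc D (fun x => cut1 r nu x * h x).
Proof.
move=> ach a b ab sub; apply: abs_continuousM => //; last exact: ach.
by apply: abs_continuous_of_C1 (@continuous_cut2 _ r nu) => x; exact: is_derive_cut1.
Qed.

End EndpointLimits.

(** * Negative spectral subspaces *)

Section NegativeSpectralSubspace.
Context (R : realType) (H : lmodType R[i]) (ip : H -> H -> R[i]).
Hypotheses (ip_def : forall x, complex.Re (ip x x) = 0 -> x = 0).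
Hypotheses (ip00 : complex.Re (ip 0 0) = 0).
Context (E : projection_measure ip).

Local Notation window N := (`[- N%:R, 0%R[%classic : set R).

Let mwindow N : measurable (window N) := measurable_itv _.

(** Projections being idempotent and self-adjoint, the spectral distribution of a
    set is a squared norm; this turns statements on projections into statements
    on measures. *)
Lemma pm_dist_norm (B : set R) x : measurable B ->
  pm_dist E x B = (complex.Re (ip (E B x) (E B x)))%:E.
Proof. by move=> mB; rewrite pm_distE// -pm_selfadjoint// pm_idem. Qed.

Lemma pm_dist0_proj0 (B : set R) x : measurable B ->
  pm_dist E x B = 0%E -> E B x = 0.
Proof. by move=> mB; rewrite pm_dist_norm// => -[/ip_def]. Qed.

Lemma proj0_pm_dist0 (B : set R) x : measurable B ->
  E B x = 0 -> pm_dist E x B = 0%E.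
Proof. by move=> mB EB; rewrite pm_dist_norm// EB ip00. Qed.

Lemma proj0S (B C : set R) x : measurable B -> measurable C -> B `<=` C ->
  E C x = 0 -> E B x = 0.
Proof.
move=> mB mC BC /(proj0_pm_dist0 mC) C0; apply: pm_dist0_proj0 => //.
apply/eqP; rewrite eq_le measure_ge0 andbT -C0.
by apply: le_measure; rewrite ?inE.
Qed.

Lemma windowS N N' x : (N <= N')%N -> E (window N') x = 0 -> E (window N) x = 0.
Proof.
move=> NN'; apply: proj0S => //; apply: subset_itvr.
by rewrite bnd_simp lerN2 ler_nat.
Qed.

(** Countable additivity of the spectral distribution: the windows exhaust the
    negative half-line. *)
Lemma window_exhaust N0 x : (forall N, (N0 <= N)%N -> E (window N) x = 0) ->
  E `]-oo, 0%R[%classic x = 0.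
Proof.
move=> EN; apply: pm_dist0_proj0 => //.
have sub : `]-oo, 0%R[%classic `<=` \bigcup_N window N.
  move=> t /=; rewrite in_itv/= => t0.
  exists (Num.truncn (- t)).+1 => //=; rewrite in_itv/= t0 andbT lerNl.
  by rewrite ltW// truncnS_gt.
have neg : (pm_dist E x).-negligible (\bigcup_N window N).
  apply: negligible_bigcup => N; apply/negligibleP => //.
  apply: proj0_pm_dist0 => //.
  by apply: (windowS (leq_maxl N N0)); apply: EN; exact: leq_maxr.
by apply/negligibleP => //; exact: negligibleS neg.
Qed.

(** The kernels of the window projections on the span of the [v i] decrease as
    the window grows, and their intersection is trivial by [window_exhaust]; in
    finite dimension one of them must vanish. The induction makes this concrete:
    if the last vector stayed dependent on the others in every large window, the
    coefficients of the dependence relation would not depend on the window. *)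
Lemma lin_indep_window n (v : 'I_n -> H) : lin_indep v ->
  (forall i, range (E `]-oo, 0%R[%classic) (v i)) ->
  exists N, lin_indep (fun i => E (window N) (v i)).
Proof.
elim: n v => [|n IH] v lv rv; first by exists 0%N => c _ [].
have proj_sum m B (c : 'I_m -> R[i]) (u : 'I_m -> H) :
    \sum_i c i *: E B (u i) = E B (\sum_i c i *: u i).
  by rewrite linear_sum; apply: eq_bigr => i _; rewrite linearZ.
have wE (k : 'I_n) : widen_ord (leqnSn n) k = lift ord_max k.
  by apply: ord_inj; rewrite lift_max.
pose v' i := v (widen_ord (leqnSn n) i).
have [||N0 lN0] := IH v'.
- move=> c c0 i.
  pose c' (j : 'I_n.+1) := if unlift ord_max j is Some k then c k else 0.
  have cw k : c' (widen_ord (leqnSn n) k) = c k.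
    by rewrite /c' wE liftK.
  rewrite -cw; apply: lv; rewrite big_ord_recr/= /c' unlift_none scale0r addr0 -[RHS]c0.
  by apply: eq_bigr => j _; rewrite -/(c' _) cw.
- by move=> i; exact: rv.
apply: contrapT => noN.
have dep N : (N0 <= N)%N -> exists a : 'I_n -> R[i],
    E (window N) (v ord_max + \sum_i a i *: v' i) = 0.
  move=> N0N; have /existsNP[c /not_implyP[c0 /existsNP[i ci]]] :
      ~ lin_indep (fun i => E (window N) (v i)) by move=> l; apply: noN; exists N.
  move: c0; rewrite proj_sum big_ord_recr/= => c0.
  have cm : c ord_max != 0.
    apply/eqP => cm0; apply: ci.
    move: c0; rewrite cm0 scale0r addr0 => /(windowS N0N).
    rewrite -proj_sum => /lN0 cw.
    have [j ->|->//] := unliftP ord_max i.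
    by rewrite -(cw j) wE.
  (* The last coefficient is nonzero by the induction hypothesis, and is
     normalized to [1] so that the other ones become unique. *)
  exists (fun j => (c ord_max)^-1 * c (widen_ord (leqnSn n) j)).
  under eq_bigr do rewrite -scalerA.
  rewrite -scaler_sumr addrC -[X in _ + X](@scalerK _ _ (c ord_max)) ?unitfE//.
  by rewrite -scalerDr linearZ /= c0 scaler0.
have [a a0] := dep N0 (leqnn _).
pose u := v ord_max + \sum_i a i *: v' i.
have u0 : E `]-oo, 0%R[%classic u = 0.
  apply: (@window_exhaust N0) => N N0N.
  have [b bN] := dep N N0N.
  have bN0 := windowS N0N bN.
  suff ab : a = b by rewrite /u ab.
  apply/funext => i; apply/eqP; rewrite -subr_eq0; apply/eqP.
  apply: (lN0 (fun i => a i - b i)).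
  rewrite proj_sum (_ : \sum_i _ = (v ord_max + \sum_i a i *: v' i) -
      (v ord_max + \sum_i b i *: v' i)); first by rewrite linearB /= a0 bN0 subrr.
  by under eq_bigr do rewrite scalerBl; rewrite sumrB opprD addrACA subrr add0r.
have uE : E `]-oo, 0%R[%classic u = u.
  have fix_v i : E `]-oo, 0%R[%classic (v i) = v i.
    by have [y _ <-] := rv i; rewrite pm_idem.
  rewrite /u linearD /= fix_v -proj_sum; congr (_ + _).
  by apply: eq_bigr => i _; rewrite fix_v.
pose c (j : 'I_n.+1) := if unlift ord_max j is Some k then a k else 1.
have : c ord_max = 0.
  apply: lv; rewrite big_ord_recr/= {2}/c unlift_none scale1r addrC -[RHS]u0 uE.
  congr (_ + _); apply: eq_bigr => k _; congr (_ *: _).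
  by rewrite /c wE liftK.
by rewrite /c unlift_none => /eqP; rewrite oner_eq0.
Qed.

Context (T : set (H * H)) (E_spectral : spectral_measure_of T E).

Section Window.
Context (N : nat) (x : H) (xN : E (window N) x = x).

Let mx := pm_dist E x.

Lemma window_dist_window : mx (window N) = mx setT.
Proof. by rewrite /mx !pm_dist_norm// xN pm_setT. Qed.

Lemma window_distC : mx (~` window N) = 0%E.
Proof.
have mC : measurable (~` window N) by exact: measurableC.
have : mx setT = (mx (window N) + mx (~` window N))%E.
  by rewrite -(setUv (window N)); apply: measureU => //; exact: setICr.
rewrite -window_dist_window.
have fin : mx (window N) \is a fin_num by rewrite /mx pm_dist_norm.
move: fin; case: (mx (window N)) => [a||]// _; case: (mx (~` window N)) => [b||]//= [].
by move=> ab; congr EFin; lra.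
Qed.

Lemma window_integral_ge0 (f : R -> R) : measurable_fun setT f ->
  (forall t, 0 <= f t) ->
  (\int[mx]_t (f t)%:E = \int[mx]_(t in window N) (f t)%:E)%E.
Proof.
move=> mf f0.
have mC : measurable (~` window N) by exact: measurableC.
rewrite (@ge0_negligible_integral _ _ _ mx setT _ _ mC)//.
- by rewrite setTD setCK.
- by apply/measurable_EFinP.
- by move=> t _; rewrite lee_fin.
- exact: window_distC.
Qed.

Lemma window_integral_fin (f : R -> R) : measurable_fun setT f ->
  (forall t, 0 <= f t) -> (exists K, forall t, window N t -> f t <= K) ->
  (\int[mx]_t (f t)%:E < +oo)%E.
Proof.
move=> mf f0 [K fK]; rewrite window_integral_ge0//.
apply: (@le_lt_trans _ _ (\int[mx]_(t in window N) (cst `|K|%:E) t)%E).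
  apply: ge0_le_integral => //.
  - by move=> t _; rewrite lee_fin.
  - by apply/measurable_EFinP; exact: measurable_funTS.
  - by move=> t tN /=; rewrite lee_fin (le_trans (fK t tN)) ?ler_norm.
rewrite integral_cst//.
by rewrite /mx pm_dist_norm// -EFinM ltry.
Qed.

(** The spectral distribution is supported in a bounded set, so the second moment
    is finite. *)
Lemma window_domain : exists y, T (x, y).
Proof.
apply/(E_spectral.1 x).
apply: (@window_integral_fin (fun t => t ^+ 2)).
- exact: measurable_funX.
- by move=> t; exact: sqr_ge0.
- exists (N%:R ^+ 2) => t; rewrite /= in_itv/= => /andP[Nt t0].
  by rewrite -sqrrN ler_pXn2r ?nnegrE ?oppr_ge0 ?(ltW t0)//; rewrite lerNl.
Qed.

(** The form is the mean of [t] against a nonzero measure carried by [t < 0]. *)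
Lemma window_negative y : x != 0 -> T (x, y) -> complex.Re (ip y x) < 0.
Proof.
move=> x0 Txy; rewrite (E_spectral.2 x y Txy) /=.
have mC : measurable (~` window N) by exact: measurableC.
have mid : measurable_fun setT (id : R -> R) by exact: measurable_id.
have mabs : measurable_fun setT (fun t : R => `|t|) by exact: measurableT_comp.
have absfin : (\int[mx]_t `|t|%:E < +oo)%E.
  apply: window_integral_fin => //; exists N%:R => t; rewrite /= in_itv/= => /andP[Nt t0].
  by rewrite ler0_norm ?(ltW t0)// lerNl.
have iid : mx.-integrable setT (EFin \o id).
  by apply/integrableP; split; [exact/measurable_EFinP|exact: absfin].
have absE := window_integral_ge0 mabs (fun t => normr_ge0 t).
have intE : (\int[mx]_t t%:E = - \int[mx]_(t in window N) `|t|%:E)%E.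
  rewrite (@negligible_integral _ _ _ mx setT _ _ mC measurableT iid window_distC).
  rewrite setTD setCK -integral_ge0N//.
  by apply: eq_integral => t; rewrite inE/= in_itv/= => /andP[_ t0]; rewrite ltr0_norm// opprK.
rewrite /Rintegral intE fineN oppr_lt0 fine_gt0//; rewrite -absE absfin andbT.
rewrite lt0e integral_ge0// andbT; apply/eqP; rewrite absE => int0.
have : ae_eq mx (window N) (EFin \o (id : R -> R)) (cst 0%E).
  apply/ae_eq_integral_abs => //.
  by apply/measurable_EFinP; exact: measurable_funTS.
move=> ae0; move/eqP : x0; apply; rewrite -xN.
apply: pm_dist0_proj0 => //; apply/negligibleP => //.
apply: negligibleS ae0 => t tN /= t0.
have [] := t0 tN => tt0.
by move: tN; rewrite /= tt0 in_itv/= ltxx andbF.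
Qed.

End Window.

(** [P x y b] is meant to say that [(x, y)] is in the operator and that [x] has
    boundary value [b]. A negative subspace meets the kernel of the boundary
    values trivially, so these embed it into a space of dimension [k]. *)
Theorem kappa_minus_le k (P : H -> H -> 'rV[R[i]]_k -> Prop) :
  (forall x y, T (x, y) -> exists b, P x y b) ->
  (forall x y b, P x y b -> T (x, y)) ->
  (forall a x y b x' y' b', P x y b -> P x' y' b' ->
     P (a *: x + x') (a *: y + y') (a *: b + b')) ->
  (forall x y, P x y 0 -> 0 <= complex.Re (ip y x)) ->
  (kappa_minus E <= k%:R%:E)%E.
Proof.
move=> TP PT Pcomb Pge0.
apply: ge_ereal_sup => _ [n [v vr lv] <-].
rewrite lee_fin ler_nat leqNgt; apply/negP => kn.
have [N lN] := lin_indep_window lv vr.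
pose x i := E (window N) (v i).
have xfix i : E (window N) (x i) = x i by rewrite pm_idem.
have Px i : exists yb, P (x i) yb.1 yb.2.
  have [y /TP[b Pb]] := window_domain (xfix i).
  by exists (y, b).
have [yb ybP] := choice Px.
have P0 : P 0 0 0.
  pose i0 := Ordinal (leq_ltn_trans (leq0n k) kn).
  by have := Pcomb (-1) _ _ _ _ _ _ (ybP i0) (ybP i0); rewrite !scaleN1r !addNr.
pose B := \matrix_(i < n) (yb i).2.
(* More rows than columns: some nonzero combination of the boundary values
   vanishes. *)
have kerB : kermx B != 0.
  rewrite kermx_eq0 /row_free neq_ltn; apply/orP; left.
  by rewrite (leq_ltn_trans (rank_leq_col _)).
have [i Bi] : exists i, row i (kermx B) != 0.
  apply: contrapT => /forallNP r0; move/eqP : kerB; apply; apply/row_matrixP => i.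
  by rewrite row0; apply/eqP; have /negP := r0 i; rewrite negbK.
pose c := row i (kermx B).
have cB : c *m B = 0 by rewrite /c -row_mul mulmx_ker row0.
have Psum (s : seq 'I_n) : P (\sum_(j <- s) c 0 j *: x j)
    (\sum_(j <- s) c 0 j *: (yb j).1) (\sum_(j <- s) c 0 j *: (yb j).2).
  by elim: s => [|j s IHs]; rewrite ?big_nil// !big_cons; exact: Pcomb.
have := Psum (index_enum _).
rewrite (_ : \sum_j c 0 j *: (yb j).2 = 0); last first.
  by rewrite -[RHS]cB mulmx_sum_row; apply: eq_bigr => j _; rewrite rowK.
set X := \sum_j c 0 j *: x j; set Y := \sum_j _ *: _ => PXY.
have X0 : X != 0.
  apply/eqP => X0; move/eqP : Bi; apply; apply/rowP => j.
  by rewrite [RHS]mxE; apply: lN.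
have XN : E (window N) X = X.
  by rewrite /X linear_sum; apply: eq_bigr => j _; rewrite linearZ /= xfix.
have := window_negative XN X0 (PT _ _ _ PXY).
by rewrite ltNge (Pge0 _ _ PXY).
Qed.

End NegativeSpectralSubspace.

(** * Classes of square integrable functions *)

Section ComplexParts.
Context (R : realType).
Implicit Types (z w : R[i]).

Lemma ReD z w : complex.Re (z + w) = complex.Re z + complex.Re w.
Proof. by case: z; case: w. Qed.

Lemma ImD z w : complex.Im (z + w) = complex.Im z + complex.Im w.
Proof. by case: z; case: w. Qed.

Lemma ReM z w : complex.Re (z * w) =
  complex.Re z * complex.Re w - complex.Im z * complex.Im w.
Proof. by case: z; case: w. Qed.

Lemma ImM z w : complex.Im (z * w) =
  complex.Re z * complex.Im w + complex.Im z * complex.Re w.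
Proof. by case: z; case: w. Qed.

Lemma ReN z : complex.Re (- z) = - complex.Re z. Proof. by case: z. Qed.
Lemma ImN z : complex.Im (- z) = - complex.Im z. Proof. by case: z. Qed.

Lemma Re_mul_conj z w : complex.Re (z * w^*) =
  complex.Re z * complex.Re w + complex.Im z * complex.Im w.
Proof. by case: z => a b; case: w => c d /=; rewrite mulrN opprK. Qed.

Lemma Re_sum (J : Type) (s : seq J) (F : J -> R[i]) :
  complex.Re (\sum_(j <- s) F j) = \sum_(j <- s) complex.Re (F j).
Proof. exact: (big_morph _ ReD). Qed.

End ComplexParts.

Section L2Facts.
Context (R : realType) (I : finType) (D : I -> interval R) (m : nat).
Local Notation mu := (@lebesgue_measure R).
Local Notation L2D := (L2 D m).
Local Open Scope quotient_scope.

Lemma ae_forall (J : finType) (P : J -> R -> Prop) :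
  (forall j, {ae mu, forall x, P j x}) -> {ae mu, forall x, forall j, P j x}.
Proof.
move=> aeP.
have : {ae mu, forall x, forall n,
    if insub n is Some k then P (enum_val (k : 'I_#|J|)) x else True}.
  apply: ae_foralln => n; case: insub => [k|]; first exact: aeP.
  exact: aeW.
by apply: ae_imp => x /[swap] j /(_ (enum_rank j)); rewrite valK enum_rankK.
Qed.

Definition L2class (F : L2fun D m) : L2D := \pi_(Quotient.quot (@L2null R I D m)) F.

Lemma L2class_represents (F : L2fun D m) : represents F (L2class F).
Proof.
move=> e; have : (L2repr (L2class F) - F) \in @L2null R I D m.
  by rewrite Quotient.idealrBE /L2repr /L2class reprK.
move=> /asboolP/(_ e); apply: ae_imp => x H /H.
by move/eqP; rewrite subr_eq0 => /eqP ->.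
Qed.

Lemma L2_combE a (u v : L2D) : a *: u + v = L2class (a *: L2repr u + L2repr v).
Proof.
by rewrite /L2class -(@pi_quot_add R[i] _ (@L2null R I D m)) /L2repr reprK.
Qed.

Lemma L2repr_comb a (u v : L2D) e : {ae mu, forall x, [set` D e] x ->
  L2repr (a *: u + v) e x = a *: L2repr u e x + L2repr v e x}.
Proof.
rewrite L2_combE.
by apply: ae_imp (L2class_represents (a *: L2repr u + L2repr v) e) => x H /H <-.
Qed.

Lemma L2_of_fun (f : I -> R -> 'cV[R[i]]_m) :
  (forall e, real_entries (sq_integrable [set` D e]) (f e)) ->
  exists u : L2D, represents f u.
Proof.
move=> f2; have fP : f \in @L2_pred R I D m by exact/asboolP.
exists (L2class (MkL2fun fP)); exact: (L2class_represents (MkL2fun fP)).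
Qed.

Lemma L2repr_sq (u : L2D) e : real_entries (sq_integrable [set` D e]) (L2repr u e).
Proof. by have /asboolP := L2funP (L2repr u). Qed.

(** Measurability has to be assumed: it does not pass through almost everywhere
    equality without completing the measure. *)
Lemma ae_sq_integrable (A : interval R) (h k : R -> R) :
  measurable_fun [set` A] h ->
  {ae mu, forall x, [set` A] x -> h x = k x} ->
  sq_integrable [set` A] k -> sq_integrable [set` A] h.
Proof.
move=> mh hk [mk k2]; split=> //.
have mA : measurable [set` A] by exact: measurable_itv.
suff -> : (\int[mu]_(x in [set` A]) (h x ^+ 2)%:E =
  \int[mu]_(x in [set` A]) (k x ^+ 2)%:E)%E by [].
apply: (@ae_eq_integral _ _ _ mu [set` A]) => //.
- by apply/measurable_EFinP; exact: measurable_funX.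
- by apply/measurable_EFinP; exact: measurable_funX.
- by apply: ae_imp hk => x H Ax; rewrite H.
Qed.

(** Allows computing with regular representatives instead of the chosen ones. *)
Lemma Re_L2ip (u v : L2D) f g : represents f u -> represents g v ->
  (forall e, real_entries (sq_integrable [set` D e]) (f e)) ->
  (forall e, real_entries (sq_integrable [set` D e]) (g e)) ->
  complex.Re (L2ip D m u v) = \sum_e \sum_i
    (\int[mu]_(x in [set` D e]) (complex.Re (f e x i 0) * complex.Re (g e x i 0)) +
     \int[mu]_(x in [set` D e]) (complex.Im (f e x i 0) * complex.Im (g e x i 0))).
Proof.
move=> fu gv f2 g2; rewrite Re_sum; apply: eq_bigr => e _.
rewrite Re_sum; apply: eq_bigr => i _ /=.
have mD : measurable [set` D e] by exact: measurable_itv.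
have [fr fi] := f2 e i 0; have [gr gi] := g2 e i 0.
have [ur ui] := L2repr_sq u e i 0; have [vr vi] := L2repr_sq v e i 0.
rewrite -(@RintegralD _ _ _ mu)//; [|exact: sq_integrableM|exact: sq_integrableM].
have mM (h k h' k' : R -> R) : sq_integrable [set` D e] h -> sq_integrable [set` D e] k ->
    sq_integrable [set` D e] h' -> sq_integrable [set` D e] k' ->
    measurable_fun [set` D e] (fun x => (h x * k x + h' x * k' x)%:E).
  move=> [mh _] [mk _] [mh' _] [mk' _]; apply/measurable_EFinP.
  by apply: measurable_funD; exact: measurable_funM.
rewrite /Rintegral; congr fine.
under eq_integral do rewrite Re_mul_conj.
apply: (@ae_eq_integral _ _ _ mu [set` D e]) => //.
- exact: (mM _ _ _ _ ur vr ui vi).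
- exact: (mM _ _ _ _ fr gr fi gi).
- by apply: ae_imp2 (fu e) (gv e) => x Hf Hg Dx; rewrite Hf// Hg.
Qed.

Lemma Re_L2ip00 : complex.Re (L2ip D m 0 0) = 0.
Proof.
have r0 : represents (fun _ _ => 0) (0 : L2D).
  move=> e; apply: ae_imp (L2repr_comb (-1) 0 0 e) => x H /H.
  by rewrite scaleN1r addNr scaleN1r addNr.
have s0 e : real_entries (sq_integrable [set` D e])
    ((fun (_ : I) (_ : R) => 0 : 'cV[R[i]]_m) e).
  move=> i j; split.
  - by rewrite (_ : (fun x => _) = cst 0); [exact: sq_integrable0|apply/funext => x; rewrite mxE].
  - by rewrite (_ : (fun x => _) = cst 0); [exact: sq_integrable0|apply/funext => x; rewrite mxE].
rewrite (Re_L2ip r0 r0 s0 s0) big1// => e _; rewrite big1// => i _.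
by rewrite /Rintegral !integral0_eq ?addr0// => x _; rewrite !mxE mul0r.
Qed.

Lemma L2ip_definite (u : L2D) : complex.Re (L2ip D m u u) = 0 -> u = 0.
Proof.
have ru : represents (L2repr u) u by move=> e; exact: aeW.
rewrite (Re_L2ip ru ru (L2repr_sq u) (L2repr_sq u)) => S0.
have ge0 (h : R -> R) e : 0 <= \int[mu]_(x in [set` D e]) (h x * h x).
  by apply: Rintegral_ge0 => x _; rewrite -expr2 sqr_ge0.
have zero e i : \int[mu]_(x in [set` D e])
      (complex.Re (L2repr u e x i 0) * complex.Re (L2repr u e x i 0)) = 0 /\
    \int[mu]_(x in [set` D e])
      (complex.Im (L2repr u e x i 0) * complex.Im (L2repr u e x i 0)) = 0.
  have /eqP := S0; rewrite psumr_eq0; last first.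
    by move=> e' _; apply: sumr_ge0 => i' _; rewrite addr_ge0.
  move=> /allP/(_ e); rewrite mem_index_enum => /(_ isT)/implyP/(_ isT).
  rewrite psumr_eq0; last by move=> i' _; rewrite addr_ge0.
  move=> /allP/(_ i); rewrite mem_index_enum => /(_ isT)/implyP/(_ isT).
  by rewrite paddr_eq0// => /andP[/eqP -> /eqP ->].
have ae0 e (h : R -> R) : sq_integrable [set` D e] h ->
    \int[mu]_(x in [set` D e]) (h x * h x) = 0 ->
    {ae mu, forall x, [set` D e] x -> h x = 0}.
  move=> h2 h0.
  have mD : measurable [set` D e] by exact: measurable_itv.
  have ih := @sq_integrableM _ _ _ _ mD h2 h2.
  have fh := @integrable_fin_num _ _ _ mu _ mD _ ih.
  have [mh _] := h2.
  have H : ae_eq mu [set` D e] (EFin \o (fun x => h x * h x)) (cst 0%E).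
    apply/(@ae_eq_integral_abs _ _ _ mu _ mD _ _).
      by apply/measurable_EFinP; exact: measurable_funM.
    rewrite (_ : (\int[mu]_(x in [set` D e]) `|(h x * h x)%:E| =
        \int[mu]_(x in [set` D e]) (h x * h x)%:E)%E).
      by rewrite -[LHS](fineK fh) -[fine _]/(\int[mu]_(x in [set` D e]) (h x * h x)) h0.
    by apply: eq_integral => x _; rewrite gee0_abs// lee_fin -expr2 sqr_ge0.
  apply: ae_imp H => x H /H /= [] /eqP; rewrite mulf_eq0 orbb => /eqP//.
suff : (L2repr u - 0) \in @L2null R I D m.
  rewrite Quotient.idealrBE => /eqP u0.
  have -> : u = L2class 0 by rewrite /L2class -u0 /L2repr reprK.
  apply: (addrI (L2class 0)).
  by rewrite addr0 /L2class (@pi_quot_add R[i] _ (@L2null R I D m)) addr0.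
rewrite subr0; apply/asboolP => e.
suff H i : {ae mu, forall x, [set` D e] x -> L2repr u e x i 0 = 0}.
  by apply: ae_imp (ae_forall H) => x Hx Dx; apply/colP => i; rewrite mxE Hx.
have [r0 i0] := zero e i; have [ur ui] := L2repr_sq u e i 0.
apply: ae_imp2 (ae0 _ _ ur r0) (ae0 _ _ ui i0) => x Hr Hi Dx.
by move: (Hr Dx) (Hi Dx); case: (L2repr u e x i 0) => a b /= -> ->.
Qed.

End L2Facts.

(** * Complex combinations in the star operators *)

Section RealParts.
Context (R : realType).
Local Notation mu := (@lebesgue_measure R).
Implicit Types (b : bool) (z w : R[i]).

(** Real and imaginary parts are treated together by indexing them with a
    boolean. *)
Definition part b z : R := if b then complex.Re z else complex.Im z.

Lemma partD b z w : part b (z + w) = part b z + part b w.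
Proof. by case: b; [exact: ReD|exact: ImD]. Qed.

Lemma partN b z : part b (- z) = - part b z.
Proof. by case: b; [exact: ReN|exact: ImN]. Qed.

Lemma part_real b (a : R) z : part b (a%:C * z) = a * part b z.
Proof. by case: b; rewrite /part ?ReM ?ImM/= mul0r ?subr0 ?addr0. Qed.

Lemma partM b a z : part b (a * z) = complex.Re a * part b z +
  (if b then - complex.Im a else complex.Im a) * part (~~ b) z.
Proof. by case: b; rewrite /part ?ReM ?ImM/= ?mulNr. Qed.

Lemma real_entriesP (P : (R -> R) -> Prop) m n (F : R -> 'M[R[i]]_(m, n)) :
  real_entries P F <-> forall b i j, P (fun x => part b (F x i j)).
Proof.
split=> [H [] i j|H i j]; [by have [] := H i j|by have [] := H i j|].
by split; [exact: (H true)|exact: (H false)].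
Qed.

Lemma mx_cvgP (F : set_system R) m n (f : R -> 'M[R[i]]_(m, n)) c :
  mx_cvg F f c <->
  forall b i j, (fun x => part b (f x i j)) @ F --> part b (c i j).
Proof.
split=> [H [] i j|H i j]; [by have [] := H i j|by have [] := H i j|].
by split; [exact: (H true)|exact: (H false)].
Qed.

Lemma mx_is_deriveP (x : R) m n (f : R -> 'M[R[i]]_(m, n)) d :
  mx_is_derive x f d <->
  forall b i j, is_derive x 1 (fun y => part b (f y i j)) (part b (d i j)).
Proof.
split=> [H [] i j|H i j]; [by have [] := H i j|by have [] := H i j|].
by split; [exact: (H true)|exact: (H false)].
Qed.

(** A property of real functions stable under real linear combinations passes,
    part by part, to complex linear combinations. *)
Lemma part_comb (P : (R -> R) -> R -> Prop) m n a
    (f g : R -> 'M[R[i]]_(m, n)) (c d : 'M[R[i]]_(m, n)) :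
  (forall h k l l', P h l -> P k l' -> P (fun x => h x + k x) (l + l')) ->
  (forall t h l, P h l -> P (fun x => t * h x) (t * l)) ->
  (forall b i j, P (fun x => part b (f x i j)) (part b (c i j))) ->
  (forall b i j, P (fun x => part b (g x i j)) (part b (d i j))) ->
  forall b i j, P (fun x => part b ((a *: f x + g x) i j)) (part b ((a *: c + d) i j)).
Proof.
move=> PD PZ Pf Pg b i j.
have E (M N : 'M[R[i]]_(m, n)) : part b ((a *: M + N) i j) = complex.Re a * part b (M i j) +
   (if b then - complex.Im a else complex.Im a) * part (~~ b) (M i j) + part b (N i j).
  by rewrite !mxE partD partM.
rewrite E; under eq_fun do rewrite E.
by apply: (PD) => //; apply: (PD); apply: (PZ).
Qed.

Lemma real_entries_comb (P : (R -> R) -> Prop) m n a (f g : R -> 'M[R[i]]_(m, n)) :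
  (forall h k, P h -> P k -> P (fun x => h x + k x)) ->
  (forall t h, P h -> P (fun x => t * h x)) ->
  real_entries P f -> real_entries P g -> real_entries P (fun x => a *: f x + g x).
Proof.
move=> PD PZ /real_entriesP Pf /real_entriesP Pg; apply/real_entriesP.
exact: (@part_comb (fun h _ => P h) _ _ a f g 0 0 (fun h k _ _ => PD h k) (fun t h _ => PZ t h)).
Qed.

Lemma mx_cvg_comb (F : set_system R) {FF : Filter F} m n a
    (f g : R -> 'M[R[i]]_(m, n)) c d :
  mx_cvg F f c -> mx_cvg F g d -> mx_cvg F (fun x => a *: f x + g x) (a *: c + d).
Proof.
move=> /mx_cvgP fc /mx_cvgP gd; apply/mx_cvgP.
apply: (@part_comb (fun h l => h @ F --> l)) => // [h k l l'|t h l hl].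
  exact: cvgD.
by apply: cvgM => //; exact: cvg_cst.
Qed.

Lemma mx_is_derive_comb (x : R) m n a (f g : R -> 'M[R[i]]_(m, n)) c d :
  mx_is_derive x f c -> mx_is_derive x g d ->
  mx_is_derive x (fun y => a *: f y + g y) (a *: c + d).
Proof.
move=> /mx_is_deriveP fc /mx_is_deriveP gd; apply/mx_is_deriveP.
apply: (@part_comb (fun h l => is_derive x 1 h l)) => // [h k l l' hl kl'|t h l hl].
  exact: is_deriveD.
exact: is_deriveZ.
Qed.

End RealParts.

Section StarOperator.
Context (R : realType) (p1 p2 m : nat) (len : 'I_p2 -> R).
Local Notation mu := (@lebesgue_measure R).
Local Notation L2G := (L2 (@edge_itv R p1 p2 len) m).
Context (Q : star_edge p1 p2 -> R -> 'M[R[i]]_m).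

Lemma SL_expression_comb (D : set R) Qe a (f f1 w g g1 v : R -> 'cV[R[i]]_m) :
  SL_expression D Qe f f1 w -> SL_expression D Qe g g1 v ->
  SL_expression D Qe (fun x => a *: f x + g x) (fun x => a *: f1 x + g1 x)
    (fun x => a *: w x + v x).
Proof.
move=> [fac f1ac df [f2 df1 wE]] [gac g1ac dg [g2 dg1 vE]].
split.
- by apply: real_entries_comb => // [h k|t h]; [exact: AC_locD|exact: AC_locZ].
- by apply: real_entries_comb => // [h k|t h]; [exact: AC_locD|exact: AC_locZ].
- apply: ae_imp2 df dg => x dfx dgx Dx.
  by apply: mx_is_derive_comb; [exact: dfx|exact: dgx].
- exists (fun x => a *: f2 x + g2 x).
    apply: ae_imp2 df1 dg1 => x dfx dgx Dx.
    by apply: mx_is_derive_comb; [exact: dfx|exact: dgx].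
  apply: ae_imp2 wE vE => x wx vx Dx; rewrite wx// vx//.
  by rewrite mulmxDr -scalemxAr scalerDr opprD addrACA scalerN.
Qed.

Lemma SL_expression_ae (D : set R) Qe (f f1 w v : R -> 'cV[R[i]]_m) :
  {ae mu, forall x, D x -> v x = w x} ->
  SL_expression D Qe f f1 w -> SL_expression D Qe f f1 v.
Proof.
move=> vw [fac f1ac df [f2 df1 wE]]; split=> //; exists f2 => //.
by apply: ae_imp2 vw wE => x H H' Dx; rewrite H// H'.
Qed.

Lemma maximal_pair_comb a f f1 g g1 (u w u' w' : L2G) :
  maximal_pair Q f f1 u w -> maximal_pair Q g g1 u' w' ->
  maximal_pair Q (fun e x => a *: f e x + g e x) (fun e x => a *: f1 e x + g1 e x)
    (a *: u + u') (a *: w + w').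
Proof.
move=> [fu SLf] [gu SLg]; split.
  move=> e; apply: ae_imp2 (L2repr_comb a u u' e) _; last first.
    exact: (ae_imp2 (fun x H H' => conj H H') (fu e) (gu e)).
  by move=> x H [Hf Hg] Dx; rewrite H// Hf// Hg.
move=> e; apply: (SL_expression_ae (L2repr_comb a w w' e)).
exact: SL_expression_comb.
Qed.

Context (alpha : star_vertex p2 -> 'M[R[i]]_m).

(** Row [0] of [A] is the common value at the centre, row [k + 1] the value at
    the [k]-th loose end. *)
Definition delta_values (f f1 : star_edge p1 p2 -> R -> 'cV[R[i]]_m)
    (A : 'M[R[i]]_(p2.+1, m)) :=
  (exists d : star_edge p1 p2 -> 'cV[R[i]]_m,
     (forall e, mx_cvg 0^'+ (f e) (row ord0 A)^T /\ mx_cvg 0^'+ (f1 e) (d e)) /\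
     \sum_e d e = alpha None *m (row ord0 A)^T) /\
  (forall k, exists d : 'cV[R[i]]_m,
     [/\ mx_cvg (len k)^'- (f (inr k)) (row (lift ord0 k) A)^T,
         mx_cvg (len k)^'- (f1 (inr k)) d &
         - d = alpha (Some k) *m (row (lift ord0 k) A)^T]).

Lemma delta_conditions_values f f1 : delta_conditions len alpha f f1 ->
  exists A, delta_values f f1 A.
Proof.
move=> [[c [d [cd dE]]] /choice[ck ckP]].
pose A : 'M[R[i]]_(p2.+1, m) := \matrix_(i, j)
  if unlift ord0 i is Some k then ck k j 0 else c j 0.
have A0 : (row ord0 A)^T = c.
  by apply/colP => j; rewrite !mxE unlift_none.
have Ak k : (row (lift ord0 k) A)^T = ck k.
  by apply/colP => j; rewrite !mxE liftK.
by exists A; split; [exists d; rewrite A0|move=> k; rewrite Ak; exact: ckP].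
Qed.

Lemma delta_values_conditions f f1 A : delta_values f f1 A ->
  delta_conditions len alpha f f1.
Proof.
move=> [[d dP] kP]; split; first by exists (row ord0 A)^T, d.
by move=> k; have [dk dkP] := kP k; exists (row (lift ord0 k) A)^T, dk.
Qed.

Lemma delta_values_comb a f f1 A g g1 B :
  delta_values f f1 A -> delta_values g g1 B ->
  delta_values (fun e x => a *: f e x + g e x) (fun e x => a *: f1 e x + g1 e x)
    (a *: A + B).
Proof.
move=> [[d [fd dE]] fk] [[d' [gd' d'E]] gk]; split.
  exists (fun e => a *: d e + d' e); rewrite !linearP; split.
    move=> e; have [? ?] := fd e; have [? ?] := gd' e.
    by split; exact: mx_cvg_comb.
  by rewrite big_split/= -scaler_sumr dE d'E.
move=> k; have [dk [fc dc fE]] := fk k; have [dk' [gc gc' gE]] := gk k.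
exists (a *: dk + dk'); rewrite !linearP; split; try exact: mx_cvg_comb.
by rewrite /= fE gE.
Qed.

End StarOperator.

(** * Nonnegativity on functions vanishing at the vertices *)

Section DirichletPart.
Context (R : realType) (p1 p2 m : nat) (len : 'I_p2 -> R).
Local Notation mu := (@lebesgue_measure R).
Local Notation edge := (star_edge p1 p2).
Local Notation L2G := (L2 (@edge_itv R p1 p2 len) m).
Context (Q : edge -> R -> 'M[R[i]]_m).
Hypotheses (len_gt0 : forall k, 0 < len k).

Definition edge_end (e : edge) : option R :=
  if e is inr k then Some (len k) else None.

Lemma edge_itvE e : edge_itv len e = edge_of (edge_end e).
Proof. by case: e. Qed.

Lemma edge_span_gt0 e : 0 < edge_span (edge_end e).
Proof. by case: e => [k|k] /=; [exact: ltr01|exact: len_gt0]. Qed.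

Context (f f1 : edge -> R -> 'cV[R[i]]_m) (u w : L2G).
Hypothesis (fuw : maximal_pair Q f f1 u w).
Context (d0 d1 : edge -> 'cV[R[i]]_m).
Hypothesis (f_ends : forall e b i,
  ends_cvg (edge_end e) (fun x => part b (f e x i 0)) 0 0 /\
  ends_cvg (edge_end e) (fun x => part b (f1 e x i 0)) (part b (d0 e i 0)) (part b (d1 e i 0))).

Local Notation D e := [set` edge_of (edge_end e)].
Local Notation pf b e i := (fun x => part b (f e x i 0)).
Local Notation pf1 b e i := (fun x => part b (f1 e x i 0)).
Local Notation pw b e i := (fun x => part b (L2repr w e x i 0)).

Lemma part_AC b e i : AC_loc (D e) (pf b e i) /\ AC_loc (D e) (pf1 b e i).
Proof.
have [_ /(_ e)[/real_entriesP fac /real_entriesP f1ac _ _]] := fuw.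
by rewrite -edge_itvE; split; [exact: fac|exact: f1ac].
Qed.

Lemma part_dirichlet (t : edge * 'I_m * bool) : exists dc : R * R,
  [/\ 0 < dc.1, 0 <= dc.2 & dirichlet_C1 (edge_end t.1.1) dc.1 dc.2
    (pf t.2 t.1.1 t.1.2) (pf1 t.2 t.1.1 t.1.2)].
Proof.
case: t => [[e i] b] /=.
have [fac f1ac] := part_AC b e i; have [fe f1e] := f_ends e b i.
have df : {ae mu, forall x, D e x -> is_derive x 1 (pf b e i) (part b (f1 e x i 0))}.
  have [_ /(_ e)[_ _ df _]] := fuw; move: df; rewrite edge_itvE.
  by apply: ae_imp => x H Dx; have /mx_is_deriveP := H Dx.
have [del [C [? ? ?]]] := dirichlet_C1_of_limits (edge_span_gt0 e) fac f1ac df fe f1e.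
by exists (del, C).
Qed.

Lemma part_sq b e i : sq_integrable (D e) (pf b e i) /\ sq_integrable (D e) (pw b e i).
Proof.
have [fac f1ac] := part_AC b e i.
have /real_entriesP w2 := L2repr_sq w e; have /real_entriesP u2 := L2repr_sq u e.
rewrite -edge_itvE; split; last exact: w2.
apply: ae_sq_integrable (u2 b i 0).
  rewrite edge_itvE; apply: measurable_fun_edge => x x0.
  exact: (AC_loc_continuous fac x0).
by have [/(_ e) fu _] := fuw; apply: ae_imp fu => x H Dx; rewrite H.
Qed.

(** [cut_f], [cut_f1] and [cut_w] are the truncated function, its derivative and
    the value of the operator on it. *)
Definition cut_f nu e x : 'cV[R[i]]_m := (cut (edge_end e) nu x)%:C *: f e x.

Definition cut_f1 nu e x : 'cV[R[i]]_m :=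
  (cut1 (edge_end e) nu x)%:C *: f e x + (cut (edge_end e) nu x)%:C *: f1 e x.

Definition cut_w nu e x : 'cV[R[i]]_m :=
  (cut (edge_end e) nu x)%:C *: L2repr w e x -
  (2 * cut1 (edge_end e) nu x)%:C *: f1 e x - (cut2 (edge_end e) nu x)%:C *: f e x.

Lemma part_cut_f nu b e i x :
  part b (cut_f nu e x i 0) = cut (edge_end e) nu x * part b (f e x i 0).
Proof. by rewrite mxE part_real. Qed.

Lemma part_cut_f1 nu b e i x : part b (cut_f1 nu e x i 0) =
  cut1 (edge_end e) nu x * part b (f e x i 0) +
  cut (edge_end e) nu x * part b (f1 e x i 0).
Proof. by rewrite !mxE partD !part_real. Qed.

Lemma part_cut_w nu b e i x : part b (cut_w nu e x i 0) =
  cut_expr (edge_end e) (pf b e i) (pf1 b e i) (pw b e i) nu x.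
Proof. by rewrite !mxE !partD !partN !part_real. Qed.

Section Cutoff.
Context (nu : R) (dc : edge * 'I_m * bool -> R * R).
Hypothesis dcP : forall t, [/\ 0 < (dc t).1, 0 <= (dc t).2 &
  dirichlet_C1 (edge_end t.1.1) (dc t).1 (dc t).2
    (pf t.2 t.1.1 t.1.2) (pf1 t.2 t.1.1 t.1.2)].
Hypothesis nuP : forall t, [/\ 1 <= nu, 2 <= nu * edge_span (edge_end t.1.1) &
  1 <= nu * (dc t).1].

Lemma cut_f_sq e : real_entries (sq_integrable [set` edge_itv len e]) (cut_f nu e).
Proof.
apply/real_entriesP => b i j; rewrite ord1 edge_itvE.
rewrite (funext (part_cut_f nu b e i)).
have [nu1 ns _] := nuP (e, i, b); have [h2 _] := part_sq b e i.
exact: cut_sq_integrable.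
Qed.

Lemma cut_w_sq e : real_entries (sq_integrable [set` edge_itv len e]) (cut_w nu e).
Proof.
apply/real_entriesP => b i j; rewrite ord1 edge_itvE.
rewrite (funext (part_cut_w nu b e i)).
have [nu1 ns nd] := nuP (e, i, b); have [h2 w2] := part_sq b e i.
have [del0 C0 hC1] := dcP (e, i, b).
exact: (cut_expr_sq_integrable (edge_span_gt0 e) C0 hC1).
Qed.

Lemma cut_SL e : SL_expression [set` edge_itv len e] (Q e) (cut_f nu e) (cut_f1 nu e)
  (cut_w nu e).
Proof.
have [_ /(_ e)[fac f1ac df [f2 df1 wE]]] := fuw.
split.
- apply/real_entriesP => b i j; rewrite ord1 edge_itvE.
  rewrite (funext (part_cut_f nu b e i)).
  by apply: AC_loc_cut; have [] := part_AC b e i.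
- apply/real_entriesP => b i j; rewrite ord1 edge_itvE.
  rewrite (funext (part_cut_f1 nu b e i)).
  have [ac ac1] := part_AC b e i.
  by apply: AC_locD; [exact: AC_loc_cut1|exact: AC_loc_cut].
- apply: ae_imp df => x H Dx; have /mx_is_deriveP dfx := H Dx.
  apply/mx_is_deriveP => b i j; rewrite ord1 part_cut_f1.
  rewrite (funext (part_cut_f nu b e i)).
  have dcut := is_derive_cut (edge_end e) nu x.
  have dM := is_deriveM dcut (dfx b i 0).
  by apply: is_derive_eq; rewrite /GRing.scale/=; ring.
exists (fun x => (cut2 (edge_end e) nu x)%:C *: f e x +
  (2 * cut1 (edge_end e) nu x)%:C *: f1 e x + (cut (edge_end e) nu x)%:C *: f2 x).
- apply: ae_imp2 df df1 => x H H1 Dx.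
  have /mx_is_deriveP dfx := H Dx; have /mx_is_deriveP df1x := H1 Dx.
  apply/mx_is_deriveP => b i j; rewrite ord1.
  rewrite (funext (part_cut_f1 nu b e i)).
  have dcut := is_derive_cut (edge_end e) nu x.
  have dcut1 := is_derive_cut1 (edge_end e) nu x.
  have dM := is_deriveD (is_deriveM dcut1 (dfx b i 0)) (is_deriveM dcut (df1x b i 0)).
  by apply: is_derive_eq; rewrite !mxE !partD !part_real /GRing.scale/=; ring.
- apply: ae_imp wE => x H Dx; rewrite /cut_w /cut_f H// -scalemxAr.
  move: (Q e x *m f e x) => X.
  by apply/colP => i; rewrite !mxE; ring.
Qed.

(** All boundary values of the truncated function and of its derivative vanish,
    so it belongs to the minimal domain, where nonnegativity is assumed. *)
Lemma cut_minimal : exists u' w' : L2G,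
  [/\ minimal_operator len Q (u', w'), represents (cut_f nu) u' &
      represents (cut_w nu) w'].
Proof.
have [u' u'P] := L2_of_fun cut_f_sq; have [w' w'P] := L2_of_fun cut_w_sq.
exists u', w'; split=> //; exists (cut_f nu), (cut_f1 nu).
have fE e b i : ends_cvg (edge_end e) (fun x => part b (cut_f nu e x i 0)) 0 0.
  have [nu1 ns nd] := nuP (e, i, b); have [del0 C0 hC1] := dcP (e, i, b).
  rewrite (funext (part_cut_f nu b e i)).
  exact: (cut_ends_cvg (edge_span_gt0 e) nu1 ns C0 nd hC1).
have f1E e b i : ends_cvg (edge_end e) (fun x => part b (cut_f1 nu e x i 0)) 0 0.
  have [nu1 ns nd] := nuP (e, i, b); have [del0 C0 hC1] := dcP (e, i, b).
  rewrite (funext (part_cut_f1 nu b e i)).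
  exact: (cut_derive_ends_cvg (edge_span_gt0 e) nu1 ns C0 nd hC1).
have part0 b i : part b ((0 : 'cV[R[i]]_m) i 0) = 0 by rewrite mxE; case: b.
split.
- split=> // e; apply: SL_expression_ae (cut_SL e).
  by apply: ae_imp (w'P e) => x H Dx; rewrite H.
- by move=> e; split; apply/mx_cvgP => b i j; rewrite ord1 part0;
    [have [] := fE e b i|have [] := f1E e b i].
- by move=> k; split; apply/mx_cvgP => b i j; rewrite ord1 part0;
    [have [_] := fE (inr k) b i|have [_] := f1E (inr k) b i].
Qed.

End Cutoff.

Lemma near_forall_fin (J : finType) (P : J -> nat -> Prop) :
  (forall j, \forall n \near \oo, P j n) -> \forall n \near \oo, forall j, P j n.
Proof.
move=> H.
have /choice[N NP] : forall j, exists N, forall n, (N <= n)%N -> P j n.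
  by move=> j; have [N _ NP] := H j; exists N.
exists (\max_j N j)%N => // n /= Nn j; apply: NP; exact: leq_trans (leq_bigmax j) Nn.
Qed.

Lemma cvg_sum_seq (J : Type) (s : seq J) (F : J -> nat -> R) (l : J -> R) :
  (forall j, F j n @[n --> \oo] --> l j) ->
  \sum_(j <- s) F j n @[n --> \oo] --> \sum_(j <- s) l j.
Proof.
move=> Fl; elim: s => [|j s IHs].
  by rewrite big_nil; under eq_fun do rewrite big_nil; exact: cvg_cst.
by rewrite big_cons; under eq_fun do rewrite big_cons; exact: cvgD.
Qed.

(** The form of the maximal operator at [u] is the limit of the forms of the
    truncations of [u], which are nonnegative. *)
Theorem dirichlet_nonneg :
  nonneg_operator (L2ip (edge_itv len) m) (minimal_operator len Q) ->
  0 <= complex.Re (L2ip (edge_itv len) m w u).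
Proof.
move=> A_ge0.
have [dc dcP] := choice part_dirichlet.
have large : \forall n \near \oo, forall t, [/\ 1 <= n%:R :> R,
    2 <= n%:R * edge_span (edge_end t.1.1) & 1 <= n%:R * (dc t).1].
  apply: near_forall_fin => t; have [del0 _ _] := dcP t.
  exact: (cutoff_large (edge_span_gt0 t.1.1) del0).
have pE : represents f u by have [] := fuw.
have wE : represents (L2repr w) w by move=> e; exact: aeW.
have f2 e : real_entries (sq_integrable [set` edge_itv len e]) (f e).
  by apply/real_entriesP => b i j; rewrite ord1 edge_itvE; have [] := part_sq b e i.
rewrite (Re_L2ip wE pE (L2repr_sq w) f2).
pose S (n : nat) : R := \sum_e \sum_i
  (\int[mu]_(x in D e) (cut_expr (edge_end e) (pf true e i) (pf1 true e i) (pw true e i) n%:R x *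
      (cut (edge_end e) n%:R x * pf true e i x)) +
   \int[mu]_(x in D e) (cut_expr (edge_end e) (pf false e i) (pf1 false e i) (pw false e i) n%:R x *
      (cut (edge_end e) n%:R x * pf false e i x))).
have Slim : S n @[n --> \oo] --> \sum_e \sum_i
    (\int[mu]_(x in D e) (pw true e i x * pf true e i x) +
     \int[mu]_(x in D e) (pw false e i x * pf false e i x)).
  apply: cvg_sum_seq => e; apply: cvg_sum_seq => i.
  have lim b : (\int[mu]_(x in D e) (cut_expr (edge_end e) (pf b e i) (pf1 b e i) (pw b e i) n%:R x *
      (cut (edge_end e) n%:R x * pf b e i x))) @[n --> \oo] -->
      \int[mu]_(x in D e) (pw b e i x * pf b e i x).
    have [h2 w2] := part_sq b e i; have [del0 C0 hC1] := dcP (e, i, b).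
    exact: (cut_energy_cvg (edge_span_gt0 e) del0 C0 hC1).
  by apply: cvgD; exact: lim.
under eq_bigr do rewrite edge_itvE.
apply: (ler_cvg_to (cvg_cst 0) Slim).
apply: filterS large => n nP.
have [u' [w' [mw ru rw]]] := cut_minimal dcP nP.
have := A_ge0 u' w' mw.
rewrite lecE => /andP[_].
rewrite (Re_L2ip rw ru (cut_w_sq dcP nP) (cut_f_sq nP)).
congr (_ <= _); apply: eq_bigr => e _; apply: eq_bigr => i _.
rewrite edge_itvE; congr (_ + _); apply: eq_Rintegral => x _.
- by rewrite -(part_cut_w _ true) -(part_cut_f _ true).
- by rewrite -(part_cut_w _ false) -(part_cut_f _ false).
Qed.

End DirichletPart.

(** * The bound on the number of negative eigenvalues *)

Theorem corollary6p2 (R : realType) (m p1 p2 : nat) (len : 'I_p2 -> R)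
    (Q : star_edge p1 p2 -> R -> 'M[R[i]]_m)
    (alpha : star_vertex p2 -> 'M[R[i]]_m)
    (m_ge1 : (1 <= m)%N)
    (p1_gt0 : (0 < p1)%N)
    (len_gt0 : forall k, 0 < len k)
    (Q_L1 : forall e, real_entries (L1fun [set` edge_itv len e]) (Q e))
    (Q_herm : forall e, {ae @lebesgue_measure R,
       forall x, [set` edge_itv len e] x -> Q e x \is hermsymmx})
    (alpha_herm : forall v, alpha v \is hermsymmx)
    (A_ge0 : nonneg_operator (L2ip (edge_itv len) m) (minimal_operator len Q))
    (E : projection_measure (L2ip (edge_itv (p1 := p1) len) m))
    (E_spectral : spectral_measure_of (delta_hamiltonian len Q alpha) E) :
  (kappa_minus E <= ((p2 + 1) * m)%:R%:E)%E.
Proof.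
rewrite addn1.
pose P (x y : L2 (@edge_itv R p1 p2 len) m) (b : 'rV[R[i]]_(p2.+1 * m)) :=
  exists f f1, maximal_pair Q f f1 x y /\ delta_values len alpha f f1 (vec_mx b).
apply: (@kappa_minus_le _ _ _ (@L2ip_definite _ _ _ m) (@Re_L2ip00 _ _ _ m) E _ E_spectral _ P).
- move=> x y [f [f1 [xy /delta_conditions_values[A AP]]]].
  by exists (mxvec A), f, f1; rewrite mxvecK.
- move=> x y b [f [f1 [xy /delta_values_conditions fc]]].
  by exists f, f1.
- move=> a x y b x' y' b' [f [f1 [xy fb]]] [g [g1 [xy' gb]]].
  exists (fun e x => a *: f e x + g e x), (fun e x => a *: f1 e x + g1 e x).
  by split; [exact: maximal_pair_comb|rewrite linearP; exact: delta_values_comb].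
- move=> x y [f [f1 [xy]]]; rewrite linear0 => -[[d0 [f0 _]] /choice[dk fk]].
  (* On a lead there is no loose end; the value [0] is a placeholder. *)
  pose d1 (e : star_edge p1 p2) : 'cV[R[i]]_m := if e is inr k then dk k else 0.
  have part0 b i : part b ((0 : 'cV[R[i]]_m) i 0) = 0 by rewrite mxE; case: b.
  have row0 i : (row i (0 : 'M[R[i]]_(p2.+1, m)))^T = 0 by apply/colP => j; rewrite !mxE.
  apply: (dirichlet_nonneg len_gt0 xy (d0 := d0) (d1 := d1)) A_ge0 => e b i.
  have [] := f0 e; rewrite row0 => /mx_cvgP/(_ b i 0); rewrite part0 => fe.
  move=> /mx_cvgP/(_ b i 0) f1e.
  case: e fe f1e => [k|k] fe f1e; split; split => //=.
  + have [/mx_cvgP/(_ b i 0)] := fk k; rewrite row0 part0//.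
  + by have [_ /mx_cvgP/(_ b i 0)] := fk k.
Qed.
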